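(* Let $\mathcal{M}$ be a type ${\rm II}_1$ factor with faithful normal tracial state $\tau$, let $\omega$ be a free ultrafilter on $\mathbb{N}$, and let $\mathcal{M}^\omega$ be the ultrapower algebra of $\mathcal{M}$, with tracial state $\tau_\omega$. For every operator $T\in \mathcal{M}^\omega$, there is a family of projections $\{P_t\}_{0\leq t\leq 1}$ in $\mathcal{M}^\omega$ such that $TP_t=P_tTP_t$ for all $t\in[0,1]$, $P_s\leq P_t$ whenever $s\leq t$, and $\tau_\omega(P_t)=t$ for all $t\in[0,1]$.
   Context: The ultrapower $\mathcal{M}^\omega$ is the quotient of the algebra $\prod_{n\in\mathbb{N}}\mathcal{M}$ of norm-bounded sequences in $\mathcal{M}$ (with pointwise operations) by the equivalence relation $\{X_n\}\sim\{Y_n\}$ iff $\lim_{n\to\omega}\|X_n-Y_n\|_2=0$, where $\|X\|_2=\tau(X^*X)^{1/2}$. It carries the tracial state $\tau_\omega((X_n))=\lim_{n\to\omega}\tau(X_n)$. (It is again a type ${\rm II}_1$ factor.) Projections are self-adjoint idempotents. *)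

(* Defs.v *)
From HB Require Import structures.
From mathcomp Require Import all_boot all_order all_algebra.
From mathcomp Require Import generic_quotient ring_quotient complex ring lra.
From mathcomp Require Import boolp classical_sets functions filter reals.
From mathcomp Require Import topology normedtype realfun.

Set Implicit Arguments.
Unset Strict Implicit.
Unset Printing Implicit Defensive.

Import Order.TTheory GRing.Theory Num.Theory.
Import numFieldNormedType.Exports.

Local Open Scope classical_set_scope.
Local Open Scope ring_scope.

(* The inner product is linear in its first argument. *)
HB.mixin Record isHilbert (R : realType) H of CompleteNormedModule R[i] H := {
  inner : H -> H -> R[i];
  inner_linear : forall (a : R[i]) (x y z : H),
    inner (a *: x + y) z = a * inner x z + inner y z;
  inner_conj : forall x y : H, inner x y = (inner y x)^*;
  inner_norm : forall x : H, inner x x = `|x| ^+ 2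
}.

#[short(type="hilbertType")]
HB.structure Definition Hilbert (R : realType) :=
  {H of isHilbert R H & CompleteNormedModule R[i] H}.

HB.mixin Record isStarAlgebra (R : realType) A of GRing.Algebra R[i] A := {
  star : A -> A;
  starK : involutive star;
  starD : {morph star : a b / a + b};
  starM : forall a b : A, star (a * b) = star b * star a;
  starZ : forall (c : R[i]) (a : A), star (c *: a) = c^* *: star a
}.

#[short(type="starAlgType")]
HB.structure Definition StarAlgebra (R : realType) :=
  {A of isStarAlgebra R A & GRing.Algebra R[i] A}.

Section StarAlgebraTheory.
Context {R : realType} {A : starAlgType R}.
Implicit Types a b p : A.

Definition projection p := star p = p /\ p * p = p.

(* The order of a C*-algebra: the positive elements are the [star c * c]. *)
Definition star_le a b := exists c : A, b - a = star c * c.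

Lemma star1 : star (1 : A) = 1.
Proof. by rewrite -[LHS]mulr1 -[X in _ * X]starK -starM mulr1 starK. Qed.

Lemma star0 : star (0 : A) = 0.
Proof. by apply: (addrI (star 0)); rewrite -starD !addr0. Qed.

Lemma starN a : star (- a) = - star a.
Proof. by apply/eqP; rewrite -addr_eq0 -starD addNr star0. Qed.

Lemma starB a b : star (a - b) = star a - star b.
Proof. by rewrite starD starN. Qed.

End StarAlgebraTheory.

Section Operators.
Context {R : realType} {H : hilbertType R}.
Implicit Types (A B : H -> H) (S : set (H -> H)) (x y z : H).

Definition bounded_op : set (H -> H) :=
  [set A | linear A /\ exists k : R[i], forall x, `|A x| <= k * `|x|].

Definition adjoint_op A B := forall x y, inner (A x) y = inner x (B y).

Definition commutant S : set (H -> H) :=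
  [set A | bounded_op A /\ forall B, S B -> A \o B = B \o A].

End Operators.

(* Von Neumann algebras acting on a nonzero Hilbert space: the *-invariant sets
   of bounded operators that are equal to their bicommutant. The adjoint is a
   relation here; it becomes the operation [star] on the elements of M. *)
Record vnAlgebra (R : realType) (H : hilbertType R) := VNAlgebra {
  vn_neq0 : exists x : H, x != 0;
  vn_set : set (H -> H);
  vn_bounded : vn_set `<=` bounded_op;
  vn_adjoint : forall A, vn_set A -> exists2 B, vn_set B & adjoint_op A B;
  vn_bicommutant : commutant (commutant vn_set) = vn_set
}.

Definition vn_pred (R : realType) (H : hilbertType R) (M : vnAlgebra H) :
  {pred H -> H} := fun A => `[< vn_set M A >].

Record vnElt (R : realType) (H : hilbertType R) (M : vnAlgebra H) := VNElt {
  vn_fun :> H -> H;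
  vn_funP : vn_pred M vn_fun
}.
Coercion vnElt : vnAlgebra >-> Sortclass.

HB.instance Definition _ (R : realType) (H : hilbertType R) (M : vnAlgebra H) :=
  [isSub for @vn_fun R H M].
HB.instance Definition _ (R : realType) (H : hilbertType R) (M : vnAlgebra H) :=
  [Choice of vnElt M by <:].

Section VNAlgebraTheory.
Context {R : realType} {H : hilbertType R}.
Implicit Types (x y z : H) (c k : R[i]).

Lemma inner0l y : inner (0 : H) y = 0.
Proof.
have := inner_linear 1 (0 : H) 0 y.
by rewrite scaler0 add0r mul1r => /eqP; rewrite -subr_eq subrr => /eqP <-.
Qed.

Lemma innerDl x y z : inner (x + y) z = inner x z + inner y z.
Proof. by rewrite -[x in LHS]scale1r inner_linear mul1r. Qed.

Lemma innerZl c x z : inner (c *: x) z = c * inner x z.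
Proof. by rewrite -[_ *: x]addr0 inner_linear inner0l addr0. Qed.

Lemma innerDr x y z : inner x (y + z) = inner x y + inner x z.
Proof.
by rewrite (inner_conj x) innerDl rmorphD /= -!inner_conj.
Qed.

Lemma innerZr c x z : inner x (c *: z) = c^* * inner x z.
Proof. by rewrite (inner_conj x) innerZl rmorphM /= -inner_conj. Qed.

Lemma inner_inj x y : (forall z, inner x z = inner y z) -> x = y.
Proof.
move=> xy; apply/eqP; rewrite -subr_eq0 -normr_eq0 -sqrf_eq0 -inner_norm.
by rewrite innerDl xy -innerDl subrr inner0l.
Qed.

Lemma bounded_normk (A : H -> H) k :
  (forall x, `|A x| <= k * `|x|) -> forall x, `|A x| <= `|k| * `|x|.
Proof.
move=> Ak x; have kx0 : 0 <= k * `|x| by exact: le_trans (Ak x).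
by rewrite -[`|x|]normr_id -normrM ger0_norm.
Qed.

Lemma bounded_op_id : bounded_op (idfun : H -> H).
Proof. by split=> //; exists 1 => x; rewrite mul1r. Qed.

Lemma bounded_op_comp (A B : H -> H) :
  bounded_op A -> bounded_op B -> bounded_op (A \o B).
Proof.
move=> [lA [k kP]] [lB [l lP]]; split; first by move=> c x y /=; rewrite lB lA.
exists (`|k| * `|l|) => x /=; apply: le_trans (bounded_normk kP _) _.
by rewrite -mulrA ler_wpM2l // bounded_normk.
Qed.

Lemma bounded_op_lin c (A B : H -> H) :
  bounded_op A -> bounded_op B -> bounded_op (c *: A + B).
Proof.
move=> [lA [k kP]] [lB [l lP]]; split.
  move=> a x y; rewrite !fctE /= lA lB !scalerDr !scalerA [c * a]mulrC.
  by rewrite addrACA.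
exists (`|c| * `|k| + `|l|) => x; rewrite fctE.
apply: le_trans (ler_normD _ _) _; rewrite mulrDl lerD ?bounded_normk //.
by rewrite fctE normrZ -mulrA ler_wpM2l // bounded_normk.
Qed.

Section Commutant.
Variable S : set (H -> H).
Hypothesis Sb : S `<=` bounded_op.

Lemma commutant_id : commutant S idfun.
Proof. by split=> //; exact: bounded_op_id. Qed.

Lemma commutant_comp (A B : H -> H) :
  commutant S A -> commutant S B -> commutant S (A \o B).
Proof.
move=> [bA cA] [bB cB]; split; first exact: bounded_op_comp.
by move=> T ST; rewrite -compA cB // compA cA.
Qed.

Lemma commutant_lin c (A B : H -> H) :
  commutant S A -> commutant S B -> commutant S (c *: A + B).
Proof.
move=> [bA cA] [bB cB]; split; first exact: bounded_op_lin.
move=> T ST; apply/funext => x; rewrite !fctE /=.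
have [lT _] := Sb ST.
have -> : A (T x) = T (A x) by exact: (congr1 (@^~ x) (cA T ST)).
have -> : B (T x) = T (B x) by exact: (congr1 (@^~ x) (cB T ST)).
by rewrite lT.
Qed.

End Commutant.

Variable M : vnAlgebra H.

Lemma vnP (A : M) : vn_set M A.
Proof. exact/asboolP/(vn_funP A). Qed.

Lemma commutant_bounded (S : set (H -> H)) : commutant S `<=` bounded_op.
Proof. by move=> A []. Qed.

Lemma vn_id : vn_set M idfun.
Proof. by rewrite -vn_bicommutant; exact: commutant_id. Qed.

Lemma vn_comp (A B : H -> H) : vn_set M A -> vn_set M B -> vn_set M (A \o B).
Proof. by rewrite -vn_bicommutant; exact: commutant_comp. Qed.

Lemma vn_lin c (A B : H -> H) :
  vn_set M A -> vn_set M B -> vn_set M (c *: A + B).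
Proof.
by rewrite -vn_bicommutant; apply: commutant_lin; exact: commutant_bounded.
Qed.

Lemma vn_submod_closed : GRing.submod_closed (vn_pred M).
Proof.
have vnA (A : M) := vnP A.
split.
  apply/asboolP; have := vn_lin (-1) vn_id vn_id.
  by rewrite scaleN1r addNr.
move=> c A B /asboolP MA /asboolP MB; exact/asboolP/vn_lin.
Qed.

HB.instance Definition _ := GRing.isSubmodClosed.Build R[i] (H -> H)
  (vn_pred M) vn_submod_closed.
HB.instance Definition _ := [SubChoice_isSubLmodule of vnElt M by <:].

Definition vn_one : M := VNElt (asboolT vn_id).
Definition vn_mul (A B : M) : M := VNElt (asboolT (vn_comp (vnP A) (vnP B))).

Lemma vn_eqP (A B : M) : (forall x, A x = B x) -> A = B.
Proof. by move=> AB; apply/val_inj/funext. Qed.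

Lemma vn_funD (A B : M) x : (A + B) x = A x + B x.
Proof. by rewrite -[LHS]/(val (A + B) x) raddfD. Qed.

Lemma vn_funZ c (A : M) x : (c *: A) x = c *: A x.
Proof. by rewrite -[LHS]/(val (c *: A) x) linearZ. Qed.

Lemma vn_linear (A : M) : linear A.
Proof. by have [] := vn_bounded (vnP A). Qed.

Lemma vn_mulA : associative vn_mul.
Proof. by move=> A B C; exact: vn_eqP. Qed.

Lemma vn_mul1 : left_id vn_one vn_mul.
Proof. by move=> A; exact: vn_eqP. Qed.

Lemma vn_mulr1 : right_id vn_one vn_mul.
Proof. by move=> A; exact: vn_eqP. Qed.

Lemma vn_mulDl : left_distributive vn_mul +%R.
Proof. by move=> A B C; apply: vn_eqP => x; rewrite [RHS]vn_funD -vn_funD. Qed.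

Lemma vn_fun_add (A : M) x y : A (x + y) = A x + A y.
Proof. by rewrite -[x in LHS]scale1r vn_linear scale1r. Qed.

Lemma vn_fun_scale (A : M) c x : A (c *: x) = c *: A x.
Proof.
have A0 : A 0 = 0.
  by apply: (addrI (A 0)); rewrite -vn_fun_add !addr0.
by rewrite -[_ *: x]addr0 vn_linear A0 addr0.
Qed.

Lemma vn_mulDr : right_distributive vn_mul +%R.
Proof.
move=> A B C; apply: vn_eqP => x; rewrite [RHS]vn_funD.
by rewrite -[RHS]/(A (B x) + A (C x)) -vn_fun_add -vn_funD.
Qed.

Lemma vn_1neq0 : vn_one != 0.
Proof.
apply/eqP => /(congr1 (@vn_fun _ _ M)) /(congr1 (fun f => f : H -> H)) e.
have [x /eqP] := vn_neq0 M; apply.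
by rewrite -[LHS]/(vn_one x) e -[0 in RHS](scale0r x) -(scale0r (0 : M)) vn_funZ
  !scale0r.
Qed.

HB.instance Definition _ := GRing.Zmodule_isNzRing.Build (vnElt M)
  vn_mulA vn_mul1 vn_mulr1 vn_mulDl vn_mulDr vn_1neq0.

Lemma vn_funM (A B : M) x : (A * B) x = A (B x).
Proof. by []. Qed.

Lemma vn_fun1 x : (1 : M) x = x.
Proof. by []. Qed.

Lemma vn_scalerAl c (A B : M) : c *: (A * B) = c *: A * B.
Proof. by apply: vn_eqP => x; rewrite vn_funM !vn_funZ vn_funM. Qed.

HB.instance Definition _ :=
  GRing.Lmodule_isLalgebra.Build R[i] (vnElt M) vn_scalerAl.

Lemma vn_scalerAr c (A B : M) : c *: (A * B) = A * (c *: B).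
Proof.
by apply: vn_eqP => x; rewrite vn_funM !vn_funZ vn_funM vn_fun_scale.
Qed.

HB.instance Definition _ :=
  GRing.Lalgebra_isAlgebra.Build R[i] (vnElt M) vn_scalerAr.

Definition vn_star (A : M) : M :=
  let B := cid2 (vn_adjoint (vnP A)) in VNElt (asboolT (s2valP B)).

Lemma vn_starP (A : M) : adjoint_op A (vn_star A).
Proof. exact: s2valP' (cid2 (vn_adjoint (vnP A))). Qed.

Lemma vn_adjoint_eq (A B C : M) : adjoint_op A B -> adjoint_op A C -> B = C.
Proof.
move=> AB AC; apply: vn_eqP => x; apply: inner_inj => z.
by rewrite inner_conj -AB AC -inner_conj.
Qed.

Lemma vn_starK : involutive vn_star.
Proof.
move=> A; apply: (vn_adjoint_eq (vn_starP _)) => x y.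
by rewrite inner_conj -vn_starP -inner_conj.
Qed.

Lemma vn_starD : {morph vn_star : A B / A + B}.
Proof.
move=> A B; apply: (vn_adjoint_eq (vn_starP _)) => x y.
by rewrite !vn_funD innerDl innerDr !vn_starP.
Qed.

Lemma vn_starM (A B : M) : vn_star (A * B) = vn_star B * vn_star A.
Proof.
apply: (vn_adjoint_eq (vn_starP _)) => x y.
by rewrite !vn_funM !vn_starP.
Qed.

Lemma vn_starZ c (A : M) : vn_star (c *: A) = c^* *: vn_star A.
Proof.
apply: (vn_adjoint_eq (vn_starP _)) => x y.
by rewrite !vn_funZ innerZl innerZr vn_starP conjCK.
Qed.

HB.instance Definition _ := isStarAlgebra.Build R (vnElt M)
  vn_starK vn_starD vn_starM vn_starZ.

Lemma inner_star (A : M) x y : inner (A x) y = inner x (star A y).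
Proof. exact: vn_starP. Qed.

Lemma inner_starl (A : M) x y : inner (star A x) y = inner x (A y).
Proof. by rewrite inner_star starK. Qed.

End VNAlgebraTheory.

Section TracialStates.
Context {R : realType} {H : hilbertType R}.

Section Positive.
Variable M : vnAlgebra H.
Implicit Types A B : M.

Definition vn_positive A := forall x : H, 0 <= inner (A x) x.

Definition vn_le A B := vn_positive (B - A).

Definition vn_factor := forall Z : M,
  (forall A, Z * A = A * Z) -> exists c : R[i], Z = c *: 1.

(* No nonzero abelian projection: the corner P M P of every nonzero projection P
   is noncommutative. *)
Definition no_abelian_projection := forall P : M, projection P ->
  (forall A B, (P * A * P) * (P * B * P) = (P * B * P) * (P * A * P)) -> P = 0.

(* The identity is not equivalent to a proper subprojection. *)
Definition vn_finite := forall V : M, star V * V = 1 -> V * star V = 1.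

Definition type_II1_factor := [/\ vn_factor, no_abelian_projection & vn_finite].

Record tracialState := TracialState {
  tr_fun :> M -> R[i];
  tr_scalar : scalar tr_fun;
  tr_ge0 : forall A, vn_positive A -> 0 <= tr_fun A;
  tr1 : tr_fun 1 = 1;
  trM : forall A B, tr_fun (A * B) = tr_fun (B * A)
}.

HB.instance Definition _ (tau : tracialState) :=
  GRing.isLinear.Build R[i] M R[i] *%R tau (tr_scalar tau).

Variable tau : tracialState.

Definition faithful_state := forall A, tau (star A * A) = 0 -> A = 0.

(* A monotone increasing net is represented by its range, an upward directed set
   D of self-adjoint operators. *)
Definition normal_state := forall (D : set M) (S : M),
  D !=set0 -> (forall A, D A -> star A = A) ->
  (forall A B, D A -> D B -> exists C, [/\ D C, vn_le A C & vn_le B C]) ->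
  (forall A, D A -> vn_le A S) ->
  (forall B, (forall A, D A -> vn_le A B) -> vn_le S B) ->
  forall c : R[i], (forall A, D A -> tau A <= c) -> tau S <= c.

(* The trace of [star A * A] is a nonnegative real number. *)
Definition norm2 A : R := Num.sqrt (complex.Re (tau (star A * A))).

End Positive.

Section TraceTheory.
Context {M : vnAlgebra H} (tau : tracialState M).
Implicit Types A B : M.

Lemma positive_starM A : vn_positive (star A * A).
Proof.
by move=> x; rewrite vn_funM inner_starl inner_norm exprn_ge0.
Qed.

Lemma tr_starM_ge0 A : 0 <= tau (star A * A).
Proof. exact/tr_ge0/positive_starM. Qed.

Definition sqnorm2 A : R := complex.Re (tau (star A * A)).

Lemma sqnorm2E A : tau (star A * A) = (sqnorm2 A)%:C%C.
Proof. by rewrite /sqnorm2 RRe_real // ger0_real // tr_starM_ge0. Qed.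

Lemma sqnorm2_ge0 A : 0 <= sqnorm2 A.
Proof. by rewrite -ler0c -sqnorm2E tr_starM_ge0. Qed.

Lemma sqnorm2_star A : sqnorm2 (star A) = sqnorm2 A.
Proof. by rewrite /sqnorm2 starK trM. Qed.

Lemma parallelogram A B :
  sqnorm2 (A + B) + sqnorm2 (A - B) = 2 * (sqnorm2 A + sqnorm2 B).
Proof.
have expand C : star (A + C) * (A + C) =
    (star A * A + star C * C) + (star A * C + star C * A).
  rewrite starD mulrDl !mulrDr (addrC (star C * A)) addrACA.
  by congr (_ + _); rewrite addrC.
apply: complexI; rewrite rmorphM !rmorphD /= -!sqnorm2E.
rewrite !expand starN !mulrNN mulrN mulNr -opprD.
rewrite -raddfD /= addrACA subrr addr0 raddfD /= raddfD /=.
by rewrite rmorph1 mulrDl mul1r.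
Qed.

Lemma sqnorm2B A B : sqnorm2 (A - B) <= 2 * (sqnorm2 A + sqnorm2 B).
Proof. by rewrite -parallelogram lerDr sqnorm2_ge0. Qed.

Lemma sqnorm2_mull A B (k : R) : (forall x, `|B x| <= k%:C%C * `|x|) ->
  sqnorm2 (B * A) <= k ^+ 2 * sqnorm2 A.
Proof.
move=> Bk; rewrite -lecR rmorphM /= -!sqnorm2E rmorphXn /= -subr_ge0.
have -> : k%:C%C ^+ 2 * tau (star A * A) = tau (k%:C%C ^+ 2 *: (star A * A)).
  by rewrite linearZ.
rewrite -raddfB /=; apply: tr_ge0 => x.
rewrite vn_funD -scaleN1r !vn_funZ innerDl !innerZl mulN1r subr_ge0.
rewrite starM !vn_funM !inner_starl.
rewrite !inner_norm.
rewrite -exprMn lerXn2r ?nnegrE //.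
by rewrite (le_trans _ (Bk _)).
Qed.

Lemma star_bound B (k : R) : 0 < k -> (forall x, `|B x| <= k%:C%C * `|x|) ->
  forall x, `|star B x| <= k%:C%C * `|x|.
Proof.
move=> k0 Bk x; set y := star B x; set c := k%:C%C.
have c0 : 0 < c by rewrite /c ltcR.
have Byx : inner (B y) x = `|y| ^+ 2 by rewrite inner_star inner_norm.
have xBy : inner x (B y) = `|y| ^+ 2 by rewrite -inner_starl inner_norm.
have By2 : `|B y| ^+ 2 <= c ^+ 2 * `|y| ^+ 2.
  by rewrite -exprMn lerXn2r ?nnegrE // ?mulr_ge0 // ?ltW.
have : 0 <= `|B y + (- c ^+ 2) *: x| ^+ 2 by exact: exprn_ge0.
rewrite -inner_norm innerDl !innerDr !innerZl !innerZr !inner_norm.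
have cr : (- c ^+ 2)^* = - c ^+ 2.
  by rewrite conj_Creal // rpredN rpredX // ger0_real // ltW.
rewrite cr Byx xBy => le0.
have : c ^+ 2 * `|y| ^+ 2 <= c ^+ 2 * (c ^+ 2 * `|x| ^+ 2).
  rewrite -subr_ge0; apply: le_trans le0 _.
  apply: (@le_trans _ _ (c ^+ 2 * `|y| ^+ 2 + - c ^+ 2 * `|y| ^+ 2 +
     (- c ^+ 2 * `|y| ^+ 2 + - c ^+ 2 * (- c ^+ 2 * `|x| ^+ 2)))).
    by rewrite -!addrA lerD2r.
  by rewrite !mulNr mulrN opprK subrr add0r addrC.
rewrite ler_pM2l ?exprn_gt0 // -exprMn ler_pXn2r ?nnegrE //.
by rewrite mulr_ge0 // ltW.
Qed.

Lemma sqnorm2_mulr A B (k : R) : 0 < k -> (forall x, `|B x| <= k%:C%C * `|x|) ->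
  sqnorm2 (A * B) <= k ^+ 2 * sqnorm2 A.
Proof.
move=> k0 Bk; rewrite -sqnorm2_star starM -(sqnorm2_star A).
exact/sqnorm2_mull/star_bound.
Qed.

Lemma tr_star A : tau (star A) = (tau A)^*.
Proof.
set b := tau (star A); set a := tau A.
have real_c (c : R[i]) : c * b + c^* * a \is Num.real.
  have := tr_starM_ge0 (A + c%:A).
  rewrite starD starZ star1 mulrDl !mulrDr.
  rewrite -!scalerAl -!scalerAr !mul1r !mulr1 !raddfD /= !linearZ /= tr1 mulr1.
  rewrite sqnorm2E -/a -/b (mulrC c^* c) -normCK => /ger0_real tot.
  have -> : c * b + c^* * a = ((sqnorm2 A)%:C%C + c * b +
      (c^* * a + `|c| ^+ 2)) - (sqnorm2 A)%:C%C - `|c| ^+ 2.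
    ring.
  by rewrite !rpredB // ?rpredX // ger0_real // ler0c sqnorm2_ge0.
have /CrealP := real_c 1; have /CrealP := real_c 'i.
rewrite !rmorphD !rmorphM /= !rmorph1 conjCK conjCi !mul1r !mulNr.
move=> h1 h2.
have {}h1 : a^* - b^* = b - a.
  by apply: (mulfI (neq0Ci _)); rewrite !mulrBr -h1 addrC.
have : 2 * a^* = 2 * b.
  have -> : 2 * a^* = (b^* + a^*) + (a^* - b^*) by ring.
  by rewrite h1 h2; ring.
by move/mulfI => -> //; rewrite pnatr_eq0.
Qed.

Lemma trB A B : tau (A - B) = tau A - tau B.
Proof. exact: raddfB. Qed.

Lemma trZ c A : tau (c *: A) = c * tau A.
Proof. exact: linearZ. Qed.

Lemma tr_le_norm2 A : `|tau A| <= (norm2 tau A)%:C%C.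
Proof.
set a := tau A.
have : 0 <= tau (star (A - a%:A) * (A - a%:A)) by exact: tr_starM_ge0.
rewrite starB starZ star1 mulrBl !mulrBr.
rewrite -!scalerAl -!scalerAr !mul1r !mulr1 !trB !trZ tr1 mulr1.
rewrite sqnorm2E tr_star -/a (mulrC a^* a) subrr subr0 -normCK subr_ge0 => le.
have n0 : 0 <= norm2 tau A by exact: sqrtr_ge0.
rewrite -(@ler_pXn2r _ 2) ?nnegrE ?normr_ge0 // ?ler0c //.
suff <- : (norm2 tau A ^+ 2)%:C%C = (norm2 tau A)%:C%C ^+ 2.
  by rewrite /norm2 sqr_sqrtr // sqnorm2_ge0.
exact: (rmorphXn (real_complex R)).
Qed.

End TraceTheory.
End TracialStates.

Record freeUltrafilter (T : Type) := FreeUltrafilter {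
  fu_filter :> set_system T;
  fu_ultra : UltraFilter fu_filter;
  fu_free : \bigcap_(A in fu_filter) A = set0
}.

#[global] Instance fu_proper_filter (T : Type) (omega : freeUltrafilter T) :
  ProperFilter (fu_filter omega).
Proof. exact: (@ultra_proper _ _ (fu_ultra omega)). Qed.

Section BoundedSequences.
Context {R : realType} {H : hilbertType R} (M : vnAlgebra H).

Definition bseq_pred : {pred nat -> M} :=
  fun X => `[< exists k : R[i], forall n x, `|X n x| <= k * `|x| >].

Record bseq := BSeq { bseq_fun :> nat -> M; bseq_funP : bseq_pred bseq_fun }.

HB.instance Definition _ := [isSub for bseq_fun].
HB.instance Definition _ := [Choice of bseq by <:].

Lemma bseqP (X : nat -> M) : bseq_pred X <->
  exists2 k : R, 0 < k & forall n x, `|X n x| <= k%:C%C * `|x|.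
Proof.
split=> [/asboolP [k kP]|[k _ kP]]; last by apply/asboolP; exists k%:C%C.
have kE : (complex.Re `|k|)%:C%C = `|k| by apply: RRe_real; exact: normr_real.
exists (complex.Re `|k| + 1) => [|n x].
  by rewrite ltr_wpDl // -ler0c kE normr_ge0.
have -> : (complex.Re `|k| + 1)%:C%C = `|k| + 1.
  by rewrite -[in RHS]kE; exact: (rmorphD (real_complex R)).
rewrite mulrDl; apply: le_trans (bounded_normk (kP n) _) _.
by rewrite lerDl mul1r.
Qed.

Lemma bseq_lin c (X Y : nat -> M) :
  bseq_pred X -> bseq_pred Y -> bseq_pred (c *: X + Y).
Proof.
move=> /bseqP [k _ Xk] /bseqP [l _ Yl]; apply/asboolP.
exists (`|c| * k%:C%C + l%:C%C) => n x.
rewrite vn_funD vn_funZ mulrDl (le_trans (ler_normD _ _)) // lerD //.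
by rewrite normrZ -mulrA ler_wpM2l.
Qed.

Lemma bseq_mul (X Y : nat -> M) :
  bseq_pred X -> bseq_pred Y -> bseq_pred (X * Y).
Proof.
move=> /bseqP [k k0 Xk] /bseqP [l _ Yl]; apply/asboolP.
exists (k%:C%C * l%:C%C) => n x.
rewrite vn_funM (le_trans (Xk _ _)) // -mulrA ler_wpM2l //.
by rewrite ler0c ltW.
Qed.

Lemma bseq1 : bseq_pred 1.
Proof. by apply/asboolP; exists 1 => n x; rewrite mul1r. Qed.

Lemma bseq_star (X : nat -> M) :
  bseq_pred X -> bseq_pred (fun n => star (X n)).
Proof.
move=> /bseqP [k k0 Xk]; apply/asboolP; exists k%:C%C => n x.
exact: star_bound.
Qed.

Lemma bseq_submod_closed : GRing.submod_closed bseq_pred.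
Proof.
split; last by move=> c X Y; exact: bseq_lin.
have := bseq_lin (-1) bseq1 bseq1.
by rewrite scaleN1r addNr.
Qed.

Lemma bseq_mulr_closed : GRing.mulr_closed bseq_pred.
Proof. by split; [exact: bseq1|move=> X Y; exact: bseq_mul]. Qed.

HB.instance Definition _ :=
  GRing.isSubmodClosed.Build R[i] (nat -> M) bseq_pred bseq_submod_closed.
HB.instance Definition _ :=
  GRing.isMulClosed.Build (nat -> M) bseq_pred bseq_mulr_closed.
HB.instance Definition _ := [SubChoice_isSubLmodule of bseq by <:].
HB.instance Definition _ := [SubZmodule_isSubNzRing of bseq by <:].

End BoundedSequences.

Section Ultrapower.
Local Open Scope quotient_scope.
Context {R : realType} {H : hilbertType R} {M : vnAlgebra H}.
Context (tau : tracialState M) (omega : freeUltrafilter nat).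
Implicit Types X Y : bseq M.

Definition null_seq : {pred bseq M} :=
  fun X => `[< norm2 tau (X n) @[n --> fu_filter omega] --> (0 : R) >].

Lemma null_seqP X :
  null_seq X <-> sqnorm2 tau (X n) @[n --> fu_filter omega] --> (0 : R).
Proof.
split=> [/asboolP X0|X0].
  have -> : (fun n => sqnorm2 tau (X n)) =
            (fun n => norm2 tau (X n) * norm2 tau (X n)).
    apply/funext => n; rewrite -expr2 /norm2 sqr_sqrtr //.
    exact: sqnorm2_ge0.
  by rewrite -[0 in X in _ --> X](mulr0 0); exact: cvgM.
apply/asboolP; rewrite -[0 in X in _ --> X]sqrtr0.
by apply: continuous_cvg X0; exact: sqrt_continuous.
Qed.

Lemma null_seq_le X Y (k : R) :
  (forall n, sqnorm2 tau (Y n) <= k * sqnorm2 tau (X n)) ->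
  null_seq X -> null_seq Y.
Proof.
move=> YX /null_seqP X0; apply/null_seqP.
apply: (@squeeze_cvgr _ _ _ _ (fun=> 0) (fun n => k * sqnorm2 tau (X n))).
- by near=> n; rewrite sqnorm2_ge0 YX.
- exact: cvg_cst.
- by rewrite -[0 in X in _ --> X](mulr0 k); apply: cvgM => //; exact: cvg_cst.
Unshelve. all: by end_near. Qed.

Lemma null_seq_zmod_closed : zmod_closed null_seq.
Proof.
split=> [|X Y /null_seqP X0 /null_seqP Y0]; apply/null_seqP.
  suff -> : (fun n => sqnorm2 tau ((0 : bseq M) n)) = cst 0 by exact: cvg_cst.
  by apply/funext => n; rewrite /sqnorm2 mulr0 raddf0.
apply: (@squeeze_cvgr _ _ _ _ (fun=> 0)
  (fun n => 2 * (sqnorm2 tau (X n) + sqnorm2 tau (Y n)))).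
- by near=> n; rewrite sqnorm2_ge0 sqnorm2B.
- exact: cvg_cst.
- have -> : (0 : R) = 2 * (0 + 0) by rewrite addr0 mulr0.
  by apply: cvgM; [exact: cvg_cst|exact: cvgD].
Unshelve. all: by end_near. Qed.

HB.instance Definition _ :=
  GRing.isZmodClosed.Build (bseq M) null_seq null_seq_zmod_closed.

Lemma null_seq_mull X Y : null_seq X -> null_seq (Y * X).
Proof.
have [k k0 Yk] := (bseqP _).1 (bseq_funP Y).
apply: (@null_seq_le _ _ (k ^+ 2)) => n.
  exact: (@sqnorm2_mull _ _ _ tau (X n) (Y n)).
Qed.

Lemma null_seq_mulr X Y : null_seq X -> null_seq (X * Y).
Proof.
have [k k0 Yk] := (bseqP _).1 (bseq_funP Y).
apply: (@null_seq_le _ _ (k ^+ 2)) => n.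
  exact: (@sqnorm2_mulr _ _ _ tau (X n) (Y n)).
Qed.

Definition bstar X : bseq M := BSeq (bseq_star (bseq_funP X)).

Lemma null_seq_star X : null_seq X -> null_seq (bstar X).
Proof.
by apply: (@null_seq_le _ _ 1) => n; rewrite sqnorm2_star mul1r.
Qed.

(* X and Y are identified when X - Y is in null_seq, see [ultrapower_eqP]. *)
Definition ultrapower := Quotient.quot null_seq.
HB.instance Definition _ := GRing.Zmodule.on ultrapower.
HB.instance Definition _ := EqQuotient.on ultrapower.
HB.instance Definition _ := Quotient.on ultrapower.

Local Notation pi := (\pi_ultrapower : bseq M -> ultrapower).

Lemma ultrapower_eqP X Y :
  pi X = pi Y <-> norm2 tau (X n - Y n) @[n --> fu_filter omega] --> (0 : R).
Proof.
split=> [/eqP|] h; last first.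
  by apply/eqP; rewrite -Quotient.idealrBE; exact/asboolP.
by move: h; rewrite -Quotient.idealrBE => /asboolP.
Qed.

Lemma ultrapower_piP X Y : pi X = pi Y <-> null_seq (X - Y).
Proof. by rewrite ultrapower_eqP; split=> /asboolP. Qed.

Lemma null_seq_repr X : null_seq (repr (pi X) - X).
Proof. by apply/ultrapower_piP; rewrite reprK. Qed.

Lemma null_seqD X Y : null_seq X -> null_seq Y -> null_seq (X + Y).
Proof. exact: (@rpredD _ null_seq). Qed.

Implicit Types x y z : ultrapower.

Definition up_one : ultrapower := pi 1.
Definition up_mul x y : ultrapower := pi (repr x * repr y).
Definition up_scale (c : R[i]) x : ultrapower := pi (c *: repr x).
Definition up_star x : ultrapower := pi (bstar (repr x)).

(* A bounded sequence converges along an ultrafilter, so this limit exists; by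
   [up_traceE] it does not depend on the representative. The regular algebra
   R[i]^o is where the library puts the topology of the complex field. *)
Definition up_trace x : R[i] :=
  lim ((tau (repr x n) : R[i]^o) @[n --> fu_filter omega]).

Lemma up_oppE X : pi (- X) = - pi X.
Proof. exact: Quotient.pi_opp. Qed.

Lemma up_addE X Y : pi (X + Y) = pi X + pi Y.
Proof. exact: Quotient.pi_add. Qed.

Lemma up_0E : 0 = pi 0.
Proof. by rewrite -[0 in RHS](subrr 0) up_addE up_oppE subrr. Qed.

Lemma up_mulE X Y : up_mul (pi X) (pi Y) = pi (X * Y).
Proof.
apply/ultrapower_piP.
have -> : repr (pi X) * repr (pi Y) - X * Y =
    repr (pi X) * (repr (pi Y) - Y) + (repr (pi X) - X) * Y.
  by rewrite mulrBr mulrBl addrA subrK.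
apply: null_seqD; [apply: null_seq_mull|apply: null_seq_mulr];
  exact: null_seq_repr.
Qed.

Lemma bseq_scaleE (c : R[i]) X : c *: X = (c *: (1 : bseq M) : bseq M) * X.
Proof.
apply/val_inj/funext => n.
by rewrite -[LHS]/(c *: X n) -[RHS]/((c *: (1 : M)) * X n) -scalerAl mul1r.
Qed.

Lemma up_scaleE c X : up_scale c (pi X) = pi (c *: X).
Proof.
apply/ultrapower_piP; rewrite -scalerBr bseq_scaleE.
exact/null_seq_mull/null_seq_repr.
Qed.

Lemma bstarB X Y : bstar (X - Y) = bstar X - bstar Y.
Proof. by apply/val_inj/funext => n; exact: starB. Qed.

Lemma up_starE X : up_star (pi X) = pi (bstar X).
Proof.
apply/ultrapower_piP; rewrite -bstarB.
exact/null_seq_star/null_seq_repr.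
Qed.

Lemma cvg_sub_eq (f g : nat -> R[i]^o) (l : R[i]^o) :
  (f n - g n) @[n --> fu_filter omega] --> (0 : R[i]^o) ->
  f n @[n --> fu_filter omega] --> l -> g n @[n --> fu_filter omega] --> l.
Proof.
move=> fg fl; have FF : Filter (fu_filter omega) by exact: filter_filter.
have := @cvgB _ _ _ _ FF _ _ _ _ fl fg; rewrite subr0.
have -> : f - (fun n => f n - g n) = g by apply/funext => n; exact: subKr.
exact.
Qed.

Lemma null_seq_tr X : null_seq X ->
  (tau (X n) : R[i]^o) @[n --> fu_filter omega] --> (0 : R[i]^o).
Proof.
move=> /asboolP X0; apply/cvgr0Pnorm_lt => e e0.
have er : (complex.Re e)%:C%C = e by rewrite RRe_real // gtr0_real.
have {}e0 : 0 < complex.Re e by rewrite -ltcR er.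
move/cvgr0Pnorm_lt: X0 => /(_ _ e0); apply: filterS => n.
rewrite ger0_norm ?sqrtr_ge0 // => Xn.
by apply: le_lt_trans (tr_le_norm2 _ _) _; rewrite -er ltcR.
Qed.

Lemma up_traceE X :
  up_trace (pi X) = lim ((tau (X n) : R[i]^o) @[n --> fu_filter omega]).
Proof.
have := null_seq_tr (null_seq_repr X); set Y := repr (pi X) => YX.
have {}YX : ((tau (Y n) : R[i]^o) - (tau (X n) : R[i]^o))
    @[n --> fu_filter omega] --> (0 : R[i]^o).
  by move: YX; under eq_fun do rewrite -[tau _]/(tau (Y _ - X _)) raddfB.
suff E :
    (fun l : R[i]^o => (tau (Y n) : R[i]^o) @[n --> fu_filter omega] --> l) =
    (fun l : R[i]^o => (tau (X n) : R[i]^o) @[n --> fu_filter omega] --> l).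
  exact: (congr1 (fun P : set R[i]^o => get P) E).
have XY : ((tau (X n) : R[i]^o) - (tau (Y n) : R[i]^o))
    @[n --> fu_filter omega] --> (0 : R[i]^o).
  have FF : Filter (fu_filter omega) by exact: filter_filter.
  have := @cvgN _ _ _ _ FF _ _ YX; rewrite oppr0.
  suff -> : - (fun n => (tau (Y n) : R[i]^o) - tau (X n)) =
            (fun n => (tau (X n) : R[i]^o) - tau (Y n)) by [].
  by apply/funext => n; exact: opprB.
apply/funext => l; apply/propext; split=> h.
  exact: (cvg_sub_eq YX h).
exact: (cvg_sub_eq XY h).
Qed.

Lemma up_ind (P : ultrapower -> Prop) : (forall X, P (pi X)) -> forall x, P x.
Proof. by move=> PX x; rewrite -[x]reprK; exact: PX. Qed.

Lemma up_mulA : associative up_mul.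
Proof.
elim/up_ind=> X; elim/up_ind=> Y; elim/up_ind=> Z.
by rewrite !up_mulE mulrA.
Qed.

Lemma up_mul1 : left_id up_one up_mul.
Proof. by elim/up_ind=> X; rewrite up_mulE mul1r. Qed.

Lemma up_mulr1 : right_id up_one up_mul.
Proof. by elim/up_ind=> X; rewrite up_mulE mulr1. Qed.

Lemma up_mulDl : left_distributive up_mul +%R.
Proof.
elim/up_ind=> X; elim/up_ind=> Y; elim/up_ind=> Z.
by rewrite -up_addE !up_mulE mulrDl up_addE.
Qed.

Lemma up_mulDr : right_distributive up_mul +%R.
Proof.
elim/up_ind=> X; elim/up_ind=> Y; elim/up_ind=> Z.
by rewrite -up_addE !up_mulE mulrDr up_addE.
Qed.

Lemma up_1neq0 : up_one != 0.
Proof.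
apply/eqP => e.
have /ultrapower_eqP : pi 1 = pi 0 by rewrite -[LHS]/up_one e -up_0E.
under eq_fun => n do rewrite -[X in norm2 _ X]/((1 : M) - 0) subr0.
have -> : norm2 tau 1 = 1 by rewrite /norm2 star1 mulr1 tr1 /= sqrtr1.
have c1 : (1 : R) @[_ --> fu_filter omega] --> (1 : R) by exact: cvg_cst.
by move/(cvg_unique (@Rhausdorff R) c1)/eqP; rewrite oner_eq0.
Qed.

HB.instance Definition _ := GRing.Zmodule_isNzRing.Build ultrapower
  up_mulA up_mul1 up_mulr1 up_mulDl up_mulDr up_1neq0.

Lemma up_scalerA (a b : R[i]) x :
  up_scale a (up_scale b x) = up_scale (a * b) x.
Proof. by elim/up_ind: x => X; rewrite !up_scaleE scalerA. Qed.

Lemma up_scale1r : left_id 1 up_scale.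
Proof. by elim/up_ind=> X; rewrite up_scaleE scale1r. Qed.

Lemma up_scalerDr : right_distributive up_scale +%R.
Proof.
move=> c; elim/up_ind=> X; elim/up_ind=> Y.
by rewrite -up_addE !up_scaleE scalerDr up_addE.
Qed.

Lemma up_scalerDl x : {morph up_scale^~ x : a b / a + b}.
Proof.
by elim/up_ind: x => X a b; rewrite !up_scaleE scalerDl up_addE.
Qed.

HB.instance Definition _ := GRing.Zmodule_isLmodule.Build R[i] ultrapower
  up_scalerA up_scale1r up_scalerDr up_scalerDl.

Lemma up_scalerAl (c : R[i]) x y : c *: (x * y) = c *: x * y.
Proof.
elim/up_ind: x => X; elim/up_ind: y => Y.
rewrite -[X in _ = X]/(up_mul (up_scale c (pi X)) (pi Y)).
rewrite -[X in X = _]/(up_scale c (up_mul (pi X) (pi Y))).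
rewrite up_mulE !up_scaleE up_mulE; congr (pi _).
by apply/val_inj/funext => n; exact: scalerAl.
Qed.

HB.instance Definition _ :=
  GRing.Lmodule_isLalgebra.Build R[i] ultrapower up_scalerAl.

Lemma up_scalerAr (c : R[i]) x y : c *: (x * y) = x * (c *: y).
Proof.
elim/up_ind: x => X; elim/up_ind: y => Y.
rewrite -[X in _ = X]/(up_mul (pi X) (up_scale c (pi Y))).
rewrite -[X in X = _]/(up_scale c (up_mul (pi X) (pi Y))).
rewrite up_mulE !up_scaleE up_mulE; congr (pi _).
by apply/val_inj/funext => n; exact: scalerAr.
Qed.

HB.instance Definition _ :=
  GRing.Lalgebra_isAlgebra.Build R[i] ultrapower up_scalerAr.

Lemma up_starK : involutive up_star.
Proof.
elim/up_ind=> X; rewrite !up_starE; congr (pi _).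
by apply/val_inj/funext => n; exact: starK.
Qed.

Lemma up_starD : {morph up_star : x y / x + y}.
Proof.
elim/up_ind=> X; elim/up_ind=> Y; rewrite -up_addE !up_starE -up_addE.
by congr (pi _); apply/val_inj/funext => n; exact: starD.
Qed.

Lemma up_starM x y : up_star (x * y) = up_star y * up_star x.
Proof.
elim/up_ind: x => X; elim/up_ind: y => Y.
rewrite -[x in up_star x]/(up_mul (pi X) (pi Y)) up_mulE !up_starE.
rewrite -[RHS]/(up_mul _ _) up_mulE.
by congr (pi _); apply/val_inj/funext => n; exact: starM.
Qed.

Lemma up_starZ (c : R[i]) x : up_star (c *: x) = c^* *: up_star x.
Proof.
elim/up_ind: x => X.
rewrite -[x in up_star x]/(up_scale c (pi X)) up_scaleE !up_starE.
rewrite -[RHS]/(up_scale _ _) up_scaleE.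
by congr (pi _); apply/val_inj/funext => n; exact: starZ.
Qed.

HB.instance Definition _ := isStarAlgebra.Build R ultrapower
  up_starK up_starD up_starM up_starZ.

End Ultrapower.

(* Main.v *)
From mathcomp Require Import all_boot all_order all_algebra.
From mathcomp Require Import complex ring lra.
From mathcomp Require Import boolp classical_sets functions filter reals.
From mathcomp Require Import topology normedtype sequences.
Require Import Defs.

(** Every operator of a diffuse finite von Neumann algebra [M] is almost upper
    triangular along a flag with arbitrarily fine trace steps, and passing to the
    ultrapower turns almost into exactly.

    The flag is a Krylov flag. Fix [T] in [M] of norm at most [k] and [N > 0], and
    build projections [0 = V_0 <= ... <= V_N = 1] with [tau V_i = i / N] by
    induction. Let [g] be the last piece added to [V]. The invariant is that [T]
    maps the older pieces into [V], that is, [(1 - V) T V = (1 - V) T g]. The range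
    projection [r] of [(1 - V) T g] lies under [1 - V], and [tau r <= tau g <= 1 / N]
    since [r] is the range of an operator that lives on [g]. Enlarge [r] inside
    [1 - V] to a projection [g'] of trace exactly [1 / N]; then [V + g'] contains
    what [T] makes out of [V], so the invariant holds for [(V + g', g')]. It gives
    [sqnorm2 ((1 - V_i) T V_i) <= k ^ 2 * tau g <= k ^ 2 / N]
    ([flag_step], [approximate_flag]).

    For [T] in the ultrapower, represented by a bounded sequence [T_n], take such
    flags [V^n] for [T_n] with [N = n + 1] and let [P_t] be the class of the
    sequence [V^n_i] with [i] the integral part of [t (n + 1)]. The operators
    [(1 - V^n_i) T_n V^n_i] tend to 0 in 2-norm, and [i / (n + 1)] tends to [t].

    The two facts about projections of [M] come from monotone sequences, which
    converge strongly in [M] ([monotone_limit]), and along which a normal trace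
    cannot jump ([normal_seq_le]).
    - [range_projection]: [1 - (1 - A (star A)) ^ n] increases to the range projection
      of a contraction [A], and it has the same trace as [1 - (1 - (star A) A) ^ n],
      which lies below every [e] such that [A e = A].
    - [intermediate_subprojection]: a greedy increasing sequence of subprojections
      reaches every trace, because no nonzero projection is minimal. Indeed a
      noncommutative corner [p M p] contains a self-adjoint [b <> 0] of trace 0, and
      the range projection of [b + |b|] is then a nontrivial subprojection of [p];
      the absolute value comes from the square root [op_sqrt]. *)

Set Implicit Arguments.
Unset Strict Implicit.
Unset Printing Implicit Defensive.

Import Order.TTheory GRing.Theory Num.Theory.
Import numFieldNormedType.Exports.

Local Open Scope classical_set_scope.
Local Open Scope ring_scope.

(** * The real Hilbert space underlying a complex one *)

Section HilbertSpace.
Context {R : realType} {H : hilbertType R}.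
Implicit Types (x y z : H).

Definition rnorm x : R := complex.Re `|x|.

Lemma rnormE x : `|x| = (rnorm x)%:C%C.
Proof. by rewrite /rnorm RRe_real // normr_real. Qed.

Lemma rnorm_ge0 x : 0 <= rnorm x.
Proof. by rewrite -ler0c -rnormE. Qed.

Lemma rnorm0 : rnorm 0 = 0.
Proof. by rewrite /rnorm normr0. Qed.

Lemma rnorm_eq0 x : rnorm x = 0 -> x = 0.
Proof. by move=> x0; apply/eqP; rewrite -normr_eq0 rnormE x0. Qed.

Lemma rnormD x y : rnorm (x + y) <= rnorm x + rnorm y.
Proof. by rewrite -lecR rmorphD /= -!rnormE ler_normD. Qed.

Lemma rnormBC x y : rnorm (x - y) = rnorm (y - x).
Proof. by rewrite /rnorm distrC. Qed.

Lemma inner_rnorm x : inner x x = (rnorm x ^+ 2)%:C%C.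
Proof. by rewrite inner_norm rnormE rmorphXn. Qed.

Lemma cvg_rnorm (u : nat -> H) (l : H) :
  (u n @[n --> \oo] --> l) <->
  (rnorm (u n - l) @[n --> \oo] --> (0 : R)).
Proof.
split=> [/cvgrPdist_lt ul|/cvgr0Pnorm_lt ul].
  apply/cvgr0Pnorm_lt => e e0; have e0' : 0 < e%:C%C by rewrite ltcR.
  have := ul _ e0'; apply: filterS => n.
  by rewrite distrC rnormE ltcR ger0_norm ?rnorm_ge0.
apply/cvgrPdist_lt => e e0.
have er : (complex.Re e)%:C%C = e by rewrite RRe_real // gtr0_real.
have e0' : 0 < complex.Re e by rewrite -ltcR er.
have := ul _ e0'; apply: filterS => n.
by rewrite distrC rnormE -{2}er ltcR ger0_norm ?rnorm_ge0.
Qed.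


Definition hcauchy (u : nat -> H) := forall e : R, 0 < e ->
  exists N, forall n, (N <= n)%N -> rnorm (u n - u N) <= e.

Lemma hcauchy_cvg (u : nat -> H) : hcauchy u ->
  u n @[n --> \oo] --> lim (u n @[n --> \oo]).
Proof.
move=> uC; have : cvg (u n @[n --> \oo]); last by [].
apply: cauchy_cvg; apply: cauchy_exP => e e0.
have er : (complex.Re e)%:C%C = e by rewrite RRe_real // gtr0_real.
have e0' : 0 < complex.Re e by rewrite -ltcR er.
have [N uN] := uC (complex.Re e / 2) (divr_gt0 e0' (ltr0Sn _ 1)).
exists (u N); rewrite -ball_normE /=.
exists N => // n /= Nn; rewrite /ball_ distrC rnormE -er ltcR.
by apply: le_lt_trans (uN n Nn) _; rewrite ltr_pdivrMr // ltr_pMr // ltr1n.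
Qed.

(** The real part of the inner product makes [H] a real Hilbert space, in which
    all estimates can be carried out in the ordered field [R]. *)
Definition rip x y : R := complex.Re (inner x y).

Lemma ReD (a b : R[i]) : complex.Re (a + b) = complex.Re a + complex.Re b.
Proof. by case: a b => [? ?] [? ?]. Qed.

Lemma ReZ (t : R) (a : R[i]) : complex.Re (t%:C%C * a) = t * complex.Re a.
Proof. by case: a => [? ?] /=; rewrite mul0r subr0. Qed.

Lemma Re_conj (a : R[i]) : complex.Re a^* = complex.Re a.
Proof. by case: a. Qed.

Lemma ripC x y : rip x y = rip y x.
Proof. by rewrite /rip inner_conj Re_conj. Qed.

Lemma ripDl x y z : rip (x + y) z = rip x z + rip y z.
Proof. by rewrite /rip innerDl ReD. Qed.

Lemma ripZl (t : R) x y : rip (t%:C%C *: x) y = t * rip x y.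
Proof. by rewrite /rip innerZl ReZ. Qed.

Lemma ripNl x y : rip (- x) y = - rip x y.
Proof.
have := ripZl (-1) x y; rewrite mulN1r => <-; congr rip.
by rewrite rmorphN /= scaleN1r.
Qed.

Lemma ripBl x y z : rip (x - y) z = rip x z - rip y z.
Proof. by rewrite ripDl ripNl. Qed.

Lemma ripDr x y z : rip z (x + y) = rip z x + rip z y.
Proof. by rewrite ripC ripDl !(ripC z). Qed.

Lemma ripZr (t : R) x y : rip x (t%:C%C *: y) = t * rip x y.
Proof. by rewrite ripC ripZl ripC. Qed.

Lemma rip_rnorm x : rip x x = rnorm x ^+ 2.
Proof. by rewrite /rip inner_rnorm. Qed.

Lemma rip_inj x y : (forall z, rip x z = rip y z) -> x = y.
Proof.
move=> xy; apply/eqP; rewrite -subr_eq0; apply/eqP/rnorm_eq0/eqP.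
by rewrite -sqrf_eq0 -rip_rnorm ripBl xy subrr.
Qed.

Lemma quad_discr (a b s : R) : 0 <= a -> 0 <= b ->
  (forall t : R, 0 <= a + 2 * t * s + t ^+ 2 * b) -> s ^+ 2 <= a * b.
Proof.
move=> a0 b0 q; have [b_eq0|bn0] := eqVneq b 0.
  have [->|sn0] := eqVneq s 0; first by rewrite expr0n mulr_ge0.
  have := q (- (a + 1) / (2 * s)); rewrite b_eq0 mulr0 addr0.
  have -> : a + 2 * (- (a + 1) / (2 * s)) * s = -1 by field.
  by rewrite lerNr oppr0 ler10.
have bp : 0 < b by rewrite lt_def bn0.
have := q (- s / b).
have -> : a + 2 * (- s / b) * s + (- s / b) ^+ 2 * b = a - s ^+ 2 / b by field.
by rewrite subr_ge0 ler_pdivrMr.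
Qed.

Lemma cauchy_schwarz x y : rip x y ^+ 2 <= rnorm x ^+ 2 * rnorm y ^+ 2.
Proof.
apply: quad_discr; rewrite ?exprn_ge0 ?rnorm_ge0 // => t.
have : 0 <= rip (x + t%:C%C *: y) (x + t%:C%C *: y).
  by rewrite rip_rnorm exprn_ge0 ?rnorm_ge0.
rewrite ripDl !ripDr !ripZl !ripZr !rip_rnorm (ripC y x).
by congr (_ <= _); ring.
Qed.

Lemma rip_le x y : `|rip x y| <= rnorm x * rnorm y.
Proof.
rewrite -(@ler_pXn2r _ 2) ?nnegrE ?mulr_ge0 ?rnorm_ge0 //.
by rewrite -normrX ger0_norm ?sqr_ge0 // exprMn cauchy_schwarz.
Qed.

Lemma cvg_rip (u : nat -> H) l y : u n @[n --> \oo] --> l ->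
  rip (u n) y @[n --> \oo] --> rip l y.
Proof.
move=> /cvg_rnorm ul; apply/subr_cvg0/norm_cvg0P.
apply: (@squeeze_cvgr _ _ _ _ (fun=> 0) 
  (fun n => rnorm (u n - l) * rnorm y)); last 2 first.
- exact: cvg_cst.
- by rewrite -[0 in X in _ --> X](mul0r (rnorm y)); apply: cvgMl.
near=> n; rewrite normr_ge0 /=.
by rewrite -ripBl rip_le.
Unshelve. all: by end_near. Qed.

End HilbertSpace.

(** * Strong limits in a von Neumann algebra *)

Section StrongLimits.
Context {R : realType} {H : hilbertType R} {M : vnAlgebra H}.
Implicit Types (x y z : H) (A B L : M) (k : R) (X Y : nat -> M).

Definition opbound k A := forall x, rnorm (A x) <= k * rnorm x.

Definition sot_cvg X L := forall x, X n x @[n --> \oo] --> L x.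

Lemma opboundE k A : opbound k A <-> forall x, `|A x| <= k%:C%C * `|x|.
Proof.
by split=> Ak x; have := Ak x; rewrite !rnormE -(rmorphM (real_complex R)) lecR.
Qed.

Lemma opbound_ex A : exists2 k, 0 < k & opbound k A.
Proof.
have [_ [c cP]] := vn_bounded (vnP A).
have /bseqP [k k0 kP] : bseq_pred (fun=> A) by apply/asboolP; exists c.
by exists k => //; apply/opboundE; exact: (kP 0).
Qed.

Lemma opboundM k l A B : 0 <= k -> opbound k A -> opbound l B ->
  opbound (k * l) (A * B).
Proof.
move=> k0 Ak Bl x; apply: le_trans (Ak _) _.
by rewrite -mulrA ler_wpM2l.
Qed.

Lemma opboundD k l A B : opbound k A -> opbound l B -> opbound (k + l) (A + B).
Proof.
by move=> Ak Bl x; rewrite vn_funD (le_trans (rnormD _ _)) // mulrDl lerD.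
Qed.

Lemma opboundW k l A : k <= l -> opbound k A -> opbound l A.
Proof.
by move=> kl Ak x; rewrite (le_trans (Ak x)) // ler_wpM2r ?rnorm_ge0.
Qed.

Lemma opbound1 : opbound 1 (1 : M).
Proof. by move=> x; rewrite vn_fun1 mul1r. Qed.

Lemma opboundN k A : opbound k A -> opbound k (- A).
Proof.
move=> Ak x; rewrite -scaleN1r vn_funZ scaleN1r.
by have -> : rnorm (- A x) = rnorm (A x) by rewrite /rnorm normrN.
Qed.

Lemma vn_funN A x : (- A) x = - A x.
Proof. by rewrite -scaleN1r vn_funZ scaleN1r. Qed.

Lemma vn_funB A B x : (A - B) x = A x - B x.
Proof. by rewrite vn_funD vn_funN. Qed.

Lemma vn_0fun x : (0 : M) x = 0.
Proof. by rewrite -(scale0r (0 : M)) vn_funZ scale0r. Qed.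

Lemma vn_fun_opp A x : A (- x) = - A x.
Proof. by rewrite -scaleN1r vn_fun_scale scaleN1r. Qed.

Lemma rip_star A x y : rip (A x) y = rip x (star A y).
Proof. by rewrite /rip inner_star. Qed.

Lemma rip_starl A x y : rip (star A x) y = rip x (A y).
Proof. by rewrite rip_star starK. Qed.

Lemma sot_uniq X L L' : sot_cvg X L -> sot_cvg X L' -> L = L'.
Proof.
move=> XL XL'; apply: vn_eqP => x.
exact: cvg_unique (XL x) (XL' x).
Qed.

Lemma sot_cst A : sot_cvg (fun=> A) A.
Proof. by move=> x; exact: cvg_cst. Qed.

Lemma sot_add X Y L L' : sot_cvg X L -> sot_cvg Y L' ->
  sot_cvg (fun n => X n + Y n) (L + L').
Proof.
move=> XL YL x; rewrite vn_funD.
under eq_fun do rewrite vn_funD.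
exact: cvgD.
Qed.

Lemma sot_opp X L : sot_cvg X L -> sot_cvg (fun n => - X n) (- L).
Proof.
move=> XL x; rewrite vn_funN.
under eq_fun do rewrite vn_funN.
exact: cvgN.
Qed.

Lemma bounded_cvg (B : H -> H) (u : nat -> H) l : bounded_op B ->
  u n @[n --> \oo] --> l -> B (u n) @[n --> \oo] --> B l.
Proof.
move=> [lB [c cP]] /cvg_rnorm ul; apply/cvg_rnorm.
have cE : (complex.Re `|c|)%:C%C = `|c| by apply: RRe_real; exact: normr_real.
apply: (@squeeze_cvgr _ _ _ _ (fun=> 0)
  (fun n => complex.Re `|c| * rnorm (u n - l))); last 2 first.
- exact: cvg_cst.
- by rewrite -[0 in X in _ --> X](mulr0 (complex.Re `|c|)); apply: cvgMr.
near=> n; rewrite rnorm_ge0 /=.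
have -> : B (u n) - B l = B (u n - l).
  by rewrite addrC -scaleN1r -lB scaleN1r addrC.
by rewrite -lecR rmorphM /= cE -!rnormE bounded_normk.
Unshelve. all: by end_near. Qed.

Lemma sot_comp X Y L L' k : (forall n, opbound k (X n)) ->
  sot_cvg X L -> sot_cvg Y L' -> sot_cvg (fun n => X n * Y n) (L * L').
Proof.
move=> Xk XL YL x; rewrite vn_funM; apply/cvg_rnorm.
have h1 := (cvg_rnorm _ _).1 (YL x).
have h2 := (cvg_rnorm _ _).1 (XL (L' x)).
apply: (@squeeze_cvgr _ _ _ _ (fun=> 0)
  (fun n => k * rnorm (Y n x - L' x) + rnorm (X n (L' x) - L (L' x))));
  last 2 first.
- exact: cvg_cst.
- have -> : (0 : R) = k * 0 + 0 by rewrite mulr0 addr0.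
  by apply: cvgD => //; exact: cvgMr.
near=> n; rewrite rnorm_ge0 /=.
have -> : X n (Y n x) - L (L' x) =
    X n (Y n x - L' x) + (X n (L' x) - L (L' x)).
  by rewrite vn_fun_add vn_fun_opp addrA subrK.
by apply: le_trans (rnormD _ _) _; rewrite lerD2r Xk.
Unshelve. all: by end_near. Qed.

Lemma sot_rip X L x y : sot_cvg X L ->
  rip (X n x) y @[n --> \oo] --> rip (L x) y.
Proof. by move=> XL; exact/cvg_rip/XL. Qed.

Lemma sot_star X L : (forall n, star (X n) = X n) -> sot_cvg X L -> star L = L.
Proof.
move=> Xs XL; apply: vn_eqP => x; apply: rip_inj => y.
rewrite rip_starl ripC.
have h : rip (X n y) x @[n --> \oo] --> rip (L x) y.
  under eq_fun do rewrite rip_star Xs ripC.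
  exact: sot_rip.
exact: (cvg_unique (@Rhausdorff R) (sot_rip XL) h).
Qed.

(** A pointwise limit of operators of [M] commutes with everything that the
    operators commute with, so the bicommutant condition puts it back in [M]. *)
Lemma sot_complete X k : (forall n, opbound k (X n)) ->
  (forall x, hcauchy (fun n => X n x)) -> exists2 L : M, sot_cvg X L & opbound k L.
Proof.
move=> Xk XC; pose l x := lim (X n x @[n --> \oo]).
have lP x : X n x @[n --> \oo] --> l x by exact/hcauchy_cvg/XC.
have lk x : rnorm (l x) <= k * rnorm x.
  apply/ler_addgt0Pr => e e0.
  have /cvg_rnorm/cvgr0Pnorm_le /(_ _ e0) [N _ hN] := lP x.
  have {}hN := hN _ (leqnn N); rewrite /= ger0_norm ?rnorm_ge0 // in hN.
  have -> : l x = X N x + (l x - X N x) by rewrite addrC subrK.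
  by rewrite (le_trans (rnormD _ _)) // lerD //; [exact: Xk|rewrite rnormBC].
have lb : bounded_op l.
  split; last by exists k%:C%C => x;
    rewrite !rnormE -(rmorphM (real_complex R)) lecR.
  move=> c x y; have h : X n (c *: x + y) @[n --> \oo] --> c *: l x + l y.
    under eq_fun do rewrite vn_linear.
    by apply: cvgD => //; apply: cvgZr.
  exact: cvg_unique (lP _) h.
have lM : vn_set M l.
  rewrite -vn_bicommutant; split=> // B [Bb Bc].
  apply/funext => x /=.
  have h : X n (B x) @[n --> \oo] --> B (l x).
    have e n : X n (B x) = B (X n x).
      by rewrite -[LHS]/((X n \o B) x) -[RHS]/((B \o X n) x) Bc //; exact: vnP.
    under eq_fun do rewrite e.
    exact: bounded_cvg.
  exact: cvg_unique (lP _) h.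
by exists (VNElt (asboolT lM)).
Qed.

End StrongLimits.

(** * Monotone sequences and normality *)

Section Monotone.
Context {R : realType} {H : hilbertType R} {M : vnAlgebra H}.
Implicit Types (x y z : H) (A B D L : M) (k : R) (X : nat -> M).

Lemma inner_selfadj A x : star A = A -> inner (A x) x = (rip (A x) x)%:C%C.
Proof.
move=> As; rewrite RRe_real //; apply/CrealP.
by rewrite -inner_conj -inner_starl As.
Qed.

Lemma pos_rip A : star A = A -> (forall x, 0 <= rip (A x) x) -> vn_positive A.
Proof. by move=> As A0 x; rewrite inner_selfadj // ler0c. Qed.

(** The Cauchy-Schwarz inequality for the form [rip (D x) y], taken at [y = D x]. *)
Lemma pos_rnorm D k : 0 <= k -> star D = D -> (forall x, 0 <= rip (D x) x) ->
  opbound k D -> forall x, rnorm (D x) ^+ 2 <= k * rip (D x) x.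
Proof.
move=> k0 Ds D0 Dk x.
have cs y : rip (D x) y ^+ 2 <= rip (D x) x * rip (D y) y.
  apply: quad_discr => // t.
  have := D0 (x + t%:C%C *: y).
  rewrite vn_fun_add vn_fun_scale !ripDl !ripDr !ripZl !ripZr.
  have -> : rip (D y) x = rip (D x) y by rewrite ripC rip_star Ds.
  by congr (_ <= _); ring.
have := cs (D x); rewrite rip_rnorm => h.
have [->|Dx0] := eqVneq (rnorm (D x)) 0; first by rewrite expr0n mulr_ge0.
have Dx2 : 0 < rnorm (D x) ^+ 2 by rewrite exprn_gt0 // lt_def Dx0 rnorm_ge0.
rewrite -(ler_pM2r Dx2) -expr2; apply: le_trans h _.
rewrite [k * _]mulrC -mulrA ler_wpM2l //.
apply: le_trans (ler_norm _) _; apply: le_trans (rip_le _ _) _.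
by rewrite expr2 mulrA ler_wpM2r ?rnorm_ge0 ?Dk.
Qed.

Lemma mono_cauchy (a : nat -> R) b : (forall n, a n <= a n.+1) ->
  (forall n, a n <= b) ->
  forall e, 0 < e -> exists N, forall n, (N <= n)%N -> a n - a N <= e.
Proof.
move=> a_incr ab e e0.
have a_homo : {homo a : m n / (m <= n)%N >-> m <= n} by exact/nondecreasing_seqP.
have ac : cvgn a.
  by apply: nondecreasing_is_cvgn => //; exists b => _ [n _ <-].
have /cvgrPdist_le /(_ _ e0) [N _ hN] := ac.
exists N => n _; have := hN N (leqnn N); rewrite /= => h.
rewrite -(lerD2r (a N)) subrK.
apply: le_trans (nondecreasing_cvgn_le a_homo ac n) _.
by rewrite -lerBlDr (le_trans (ler_norm _) h).
Qed.

(** Bounded monotone sequences converge strongly: the norm of an increment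
    [X n - X m] is controlled by the increment of the quadratic form, through
    the Cauchy-Schwarz inequality of that positive operator. *)
Lemma monotone_limit X k : 0 <= k -> (forall n, star (X n) = X n) ->
  (forall n, opbound k (X n)) ->
  (forall n x, rip (X n x) x <= rip (X n.+1 x) x) ->
  exists L : M, [/\ star L = L, sot_cvg X L & opbound k L].
Proof.
move=> k0 Xs Xk Xi.
have Xh x : {homo (fun n => rip (X n x) x) : m n / (m <= n)%N >-> m <= n}.
  by apply/nondecreasing_seqP => n.
have Xc x : hcauchy (fun n => X n x).
  move=> e e0.
  have e1 : 0 < e ^+ 2 / (2 * k + 1).
    by rewrite divr_gt0 ?exprn_gt0 // ltr_wpDl // mulr_ge0.
  have Xx n : rip (X n x) x <= k * rnorm x * rnorm x.
    apply: le_trans (ler_norm _) _; apply: le_trans (rip_le _ _) _.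
    by rewrite ler_wpM2r ?rnorm_ge0 ?Xk.
  have [N hN] := mono_cauchy (fun n => Xi n x) Xx e1.
  exists N => n Nn.
  have Dx : rnorm ((X n - X N) x) ^+ 2 <= (2 * k) * rip ((X n - X N) x) x.
    apply: pos_rnorm => [|||]; first by rewrite mulr_ge0.
    - by rewrite starB !Xs.
    - by move=> y; rewrite vn_funB ripBl subr_ge0; exact: Xh.
    - have -> : 2 * k = k + k by ring.
      by apply: opboundD; [exact: Xk|exact/opboundN/Xk].
  rewrite -(@ler_pXn2r _ 2) ?nnegrE ?rnorm_ge0 ?(ltW e0) //.
  rewrite -vn_funB; apply: le_trans Dx _.
  rewrite vn_funB ripBl.
  apply: (@le_trans _ _ ((2 * k) * (e ^+ 2 / (2 * k + 1)))).
    by rewrite ler_wpM2l ?mulr_ge0 // hN.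
  rewrite mulrA ler_pdivrMr ?ltr_wpDl ?mulr_ge0 // mulrC.
  rewrite ler_wpM2l ?exprn_ge0 ?ltW //.
  by rewrite ltrDl.
have [L XL Lk] := sot_complete Xk Xc.
by exists L; split => //; exact: sot_star XL.
Qed.

Lemma sot_rip_ge X L x c : sot_cvg X L ->
  (\forall n \near \oo, c <= rip (X n x) x) -> c <= rip (L x) x.
Proof. by move=> XL; exact: (cvgr_to_ge (sot_rip XL)). Qed.

Lemma sot_rip_le X L x c : sot_cvg X L ->
  (\forall n \near \oo, rip (X n x) x <= c) -> rip (L x) x <= c.
Proof. by move=> XL; exact: (cvgr_to_le (sot_rip XL)). Qed.

Lemma sot_rip_incr X L x : (forall n x, rip (X n x) x <= rip (X n.+1 x) x) ->
  sot_cvg X L -> forall n, rip (X n x) x <= rip (L x) x.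
Proof.
move=> Xi XL m.
have Xh : {homo (fun n => rip (X n x) x) : m n / (m <= n)%N >-> m <= n}.
  by apply/nondecreasing_seqP => n.
by apply: sot_rip_ge XL _; exists m => // n; exact: Xh.
Qed.

(** For an increasing sequence the strong limit is the least upper bound among
    all operators of [M], because quadratic forms pass to the limit. *)
Lemma normal_seq_le (tau : tracialState M) X L (c : R[i]) : normal_state tau ->
  (forall n, star (X n) = X n) ->
  (forall n x, rip (X n x) x <= rip (X n.+1 x) x) ->
  sot_cvg X L -> (forall n, tau (X n) <= c) -> tau L <= c.
Proof.
move=> tauN Xs Xi XL Xc.
have Xh x : {homo (fun n => rip (X n x) x) : m n / (m <= n)%N >-> m <= n}.
  by apply/nondecreasing_seqP => n.
have Ls := sot_star Xs XL.
have le_rip A B : star A = A -> star B = B ->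
    (forall x, rip (A x) x <= rip (B x) x) -> vn_le A B.
  move=> As Bs AB; apply: pos_rip => [|x]; first by rewrite starB As Bs.
  by rewrite vn_funB ripBl subr_ge0.
apply: (tauN [set X n | n in setT]) => //.
- by exists (X 0%N); exists 0%N.
- by move=> _ [n _ <-].
- move=> _ _ [m _ <-] [n _ <-]; exists (X (maxn m n)); split.
  + by exists (maxn m n).
  + by apply: le_rip => // x; apply: Xh; exact: leq_maxl.
  + by apply: le_rip => // x; apply: Xh; exact: leq_maxr.
- by move=> _ [n _ <-]; apply: le_rip => // x; exact: sot_rip_incr.
- move=> B BX.
  have B0 n x : 0 <= inner (B x) x - (rip (X n x) x)%:C%C.
    have /(_ x) : vn_positive (B - X n) by apply: BX; exists n.
    rewrite vn_funB innerDl -scaleN1r innerZl mulN1r.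
    by rewrite (inner_selfadj _ (Xs n)).
  have BE x : inner (B x) x = (rip (B x) x)%:C%C.
    rewrite /rip RRe_real // -[inner _ _](subrK (rip (X 0%N x) x)%:C%C).
    rewrite rpredD //; first by rewrite ger0_real ?B0.
    by apply/complex_realP; exists (rip (X 0%N x) x).
  move=> x; rewrite vn_funB innerDl -scaleN1r innerZl mulN1r.
  rewrite (inner_selfadj _ Ls) BE -rmorphB ler0c subr_ge0.
  apply: sot_rip_le XL _; exists 0%N => // n _.
  by rewrite -subr_ge0 -ler0c rmorphB /= -BE.
- by move=> _ [n _ <-].
Qed.

End Monotone.

(** * Square roots *)

Section SquareRoot.
Context {R : realType} {H : hilbertType R} {M : vnAlgebra H}.
Implicit Types (x y z : H) (A B D L : M) (k : R) (X : nat -> M).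

Lemma opboundZ (t : R) k A : 0 <= t -> opbound k A -> opbound (t * k) (t%:C%C *: A).
Proof.
move=> t0 Ak x; rewrite vn_funZ.
have -> : rnorm (t%:C%C *: A x) = t * rnorm (A x).
  apply: complexI; rewrite -rnormE normrZ rnormE rmorphM /=; congr (_ * _).
  by rewrite ger0_norm // ler0c.
by rewrite -mulrA ler_wpM2l.
Qed.

Lemma opboundB k l A B : opbound k A -> opbound l B -> opbound (k + l) (A - B).
Proof. by move=> Ak Bl; apply: opboundD => //; exact: opboundN. Qed.

Lemma half_twice A : (2^-1 : R)%:C%C *: (A + A) = A.
Proof.
rewrite -[X in X + _]scale1r -[X in _ + X]scale1r -scalerDl scalerA.
have -> : (1 + 1 : R[i]) = (2 : R)%:C%C by rewrite rmorphD /= rmorph1.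
by rewrite -rmorphM /= mulVf ?pnatr_eq0 // scale1r.
Qed.

Fixpoint sqrt_iter A (n : nat) : M :=
  if n is n'.+1 then
    (2^-1 : R)%:C%C *: (A + sqrt_iter A n' * sqrt_iter A n')
  else 0.

Fixpoint sqrt_bound (n : nat) : R :=
  if n is n'.+1 then 2^-1 * (1 + sqrt_bound n' ^+ 2) else 0.

Lemma sqrt_bound01 n : 0 <= sqrt_bound n <= 1.
Proof.
elim: n => [|n /andP[h0 h1]] /=; first by rewrite lexx ler01.
have h2 : sqrt_bound n ^+ 2 <= 1 by rewrite expr_le1.
apply/andP; split; last by lra.
by rewrite mulr_ge0 ?invr_ge0 ?addr_ge0 ?exprn_ge0 ?ler01 ?ler0n.
Qed.

Lemma sqrt_bound_incr n : sqrt_bound n <= sqrt_bound n.+1.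
Proof.
have -> : sqrt_bound n.+1 = sqrt_bound n + 2^-1 * (1 - sqrt_bound n) ^+ 2.
  by rewrite /=; field.
by rewrite lerDl mulr_ge0 ?invr_ge0 ?ler0n ?sqr_ge0.
Qed.

Lemma sqrt_iter_bound A n : opbound 1 A -> opbound (sqrt_bound n) (sqrt_iter A n).
Proof.
move=> A1; elim: n => [|n IH] /=.
  by move=> x; rewrite mul0r vn_0fun rnorm0.
have /andP[y0 _] := sqrt_bound01 n.
apply: opboundZ; first by rewrite invr_ge0 ler0n.
apply: opboundD => //.
by rewrite expr2; exact: opboundM.
Qed.

(** Uses [Y' ^ 2 - Y ^ 2 = Y' (Y' - Y) + (Y' - Y) Y], which holds without any
    commutation and has the scalar counterpart with the same shape. *)
Lemma sqrt_iter_step A n : opbound 1 A ->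
  opbound (sqrt_bound n.+1 - sqrt_bound n) (sqrt_iter A n.+1 - sqrt_iter A n).
Proof.
move=> A1; elim: n => [|n IH].
  have -> : sqrt_iter A 0 = 0 by [].
  have -> : sqrt_bound 1 - sqrt_bound 0 = sqrt_bound 1 by exact: subr0.
  rewrite subr0.
  exact: (@sqrt_iter_bound A 1).
have /andP[y0 _] := sqrt_bound01 n.
have /andP[y1 _] := sqrt_bound01 n.+1.
set y := sqrt_bound n in y0 IH *; set y' := sqrt_bound n.+1 in y1 IH *.
set Y := sqrt_iter A n in IH *; set Y' := sqrt_iter A n.+1 in IH *.
have -> : sqrt_iter A n.+2 - Y' =
    (2^-1 : R)%:C%C *: (Y' * (Y' - Y) + (Y' - Y) * Y).
  rewrite mulrBr mulrBl addrA subrK.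
  rewrite [sqrt_iter A n.+2]/= -/(sqrt_iter A n.+1) -/Y'.
  have -> : Y' = (2^-1 : R)%:C%C *: (A + Y * Y) by [].
  by rewrite -scalerBr opprD addrACA subrr add0r.
have -> : sqrt_bound n.+2 - y' = 2^-1 * (y' * (y' - y) + (y' - y) * y).
  have -> : sqrt_bound n.+2 = 2^-1 * (1 + y' ^+ 2) by [].
  have -> : y' = 2^-1 * (1 + y ^+ 2) by [].
  by field.
have Yb : opbound y Y by exact: sqrt_iter_bound.
have Yb' : opbound y' Y' by exact: sqrt_iter_bound.
apply: opboundZ; first by rewrite invr_ge0 ler0n.
apply: opboundD; apply: opboundM => //.
by rewrite subr_ge0 sqrt_bound_incr.
Qed.

(** The iteration [Y' = (A + Y ^ 2) / 2] is dominated, with its increments, by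
    the scalar iteration started from the norm bound 1 of [A], which increases
    to 1; so it converges in norm, to a solution of [(1 - Y) ^ 2 = 1 - A]. *)
Lemma op_sqrt A : star A = A -> opbound 1 A ->
  exists Z : M, [/\ star Z = Z, Z * Z = 1 - A, opbound 1 (1 - Z) &
    forall B, B * A = A * B -> B * Z = Z * B].
Proof.
move=> As A1; pose Y := sqrt_iter A.
have Yb n : opbound 1 (Y n).
  by apply: opboundW (sqrt_iter_bound n A1); case/andP: (sqrt_bound01 n).
have Ydiff n p : opbound (sqrt_bound (p + n) - sqrt_bound n) (Y (p + n)%N - Y n).
  elim: p => [|p IH].
    by move=> x; rewrite !add0n !subrr mul0r vn_0fun rnorm0.
  have -> : Y (p.+1 + n)%N - Y n =
      (Y (p + n).+1 - Y (p + n)%N) + (Y (p + n)%N - Y n).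
    by rewrite addrA subrK.
  have -> : sqrt_bound (p.+1 + n) - sqrt_bound n =
      (sqrt_bound (p + n).+1 - sqrt_bound (p + n)) +
      (sqrt_bound (p + n) - sqrt_bound n) by rewrite addrA subrK.
  by apply: opboundD => //; exact: sqrt_iter_step.
have Yc x : hcauchy (fun n => Y n x).
  move=> e e0; have e1 : 0 < e / (rnorm x + 1).
    by rewrite divr_gt0 // ltr_wpDl ?rnorm_ge0.
  have [N hN] := mono_cauchy sqrt_bound_incr
    (fun n => proj2 (andP (sqrt_bound01 n))) e1.
  exists N => n Nn; rewrite -vn_funB -(subnK Nn).
  apply: le_trans (Ydiff N (n - N)%N x) _.
  rewrite subnK //; apply: le_trans (ler_wpM2r (rnorm_ge0 _) (hN _ Nn)) _.
  rewrite -mulrA ler_piMr ?(ltW e0) // mulrC ler_pdivrMr ?ltr_wpDl ?rnorm_ge0 //.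
  by rewrite mul1r lerDl.
have Ys n : star (Y n) = Y n.
  elim: n => [|n IH]; first exact: star0.
  by rewrite /Y /= starZ starD starM -/(Y n) IH As conj_Creal // complex_real.
have [L YL Lb] := sot_complete Yb Yc.
have Ls := sot_star Ys YL.
have L2 : L + L = A + L * L.
  have h1 : sot_cvg (fun n => Y n.+1 + Y n.+1) (L + L).
    by apply: sot_add => x; rewrite (@cvg_shiftS _ (fun n => Y n x)); exact: YL.
  have h2 : sot_cvg (fun n => A + Y n * Y n) (A + L * L).
    by apply: sot_add; [exact: sot_cst|exact: (sot_comp Yb YL YL)].
  have e n : Y n.+1 + Y n.+1 = A + Y n * Y n.
    have -> : Y n.+1 = (2^-1 : R)%:C%C *: (A + Y n * Y n) by [].
    by rewrite -scalerDr half_twice.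
  by apply: sot_uniq h1 _ => x; under eq_fun do rewrite e; exact: h2.
exists (1 - L); split.
- by rewrite starB star1 Ls.
- rewrite mulrBl mul1r mulrBr mulr1 opprB.
  have -> : 1 - L + (L * L - L) = 1 + L * L - (L + L).
    by rewrite opprD !addrA (addrAC 1 (- L)).
  by rewrite L2 opprD addrA (addrAC 1 (L * L)) addrK.
- by rewrite opprB addrC subrK.
- move=> B BA; have BY n : B * Y n = Y n * B.
    elim: n => [|n IH]; first by rewrite mulr0 mul0r.
    rewrite /Y /= -scalerAr -scalerAl mulrDr mulrDl BA -/(Y n) mulrA IH.
    by rewrite -!mulrA IH.
  rewrite mulrBr mulrBl mulr1 mul1r; congr (_ - _).
  have [k _ Bk] := opbound_ex B.
  have h1 : sot_cvg (fun n => B * Y n) (B * L).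
    by apply: (@sot_comp _ _ _ (fun=> B) Y B L k) => //; exact: sot_cst.
  have h2 : sot_cvg (fun n => Y n * B) (L * B).
    by apply: (@sot_comp _ _ _ Y (fun=> B) L B 1) => //; exact: sot_cst.
  by apply: sot_uniq h1 _ => x; under eq_fun do rewrite BY; exact: h2.
Qed.

End SquareRoot.

(** * Range projections *)

Section RangeProjection.
Context {R : realType} {H : hilbertType R} {M : vnAlgebra H}.
Implicit Types (x y z : H) (A B D L Z : M) (k : R) (X : nat -> M).

Lemma opbound_star k A : 0 < k -> opbound k A -> opbound k (star A).
Proof. by move=> k0 /opboundE Ak; apply/opboundE; exact: star_bound. Qed.

Lemma opboundX Z n : opbound 1 Z -> opbound 1 (Z ^+ n).
Proof.
move=> Z1; elim: n => [|n IH]; first by rewrite expr0; exact: opbound1.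
by rewrite exprS -[1]mulr1; exact: opboundM.
Qed.

Lemma star_exp Z n : star Z = Z -> star (Z ^+ n) = Z ^+ n.
Proof.
move=> Zs; elim: n => [|n IH]; first by rewrite expr0 star1.
by rewrite exprS starM IH Zs -exprSr exprS.
Qed.

Lemma rip_starM A x : rip ((star A * A) x) x = rnorm (A x) ^+ 2.
Proof. by rewrite vn_funM rip_starl rip_rnorm. Qed.

Lemma rnorm0_eq0 A : (forall x, rnorm (A x) = 0) -> A = 0.
Proof.
move=> A0; by apply: vn_eqP => x; rewrite (rnorm_eq0 (A0 x)) vn_0fun.
Qed.

Lemma starM_eq0 A : star A * A = 0 -> A = 0.
Proof.
move=> A0; apply: rnorm0_eq0 => x; apply/eqP; rewrite -sqrf_eq0.
by rewrite -rip_starM A0 vn_0fun -(subrr x) ripBl subrr.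
Qed.

(** The trace version of the fact that [A B] and [B A] have the same nonzero
    spectrum. *)
Lemma tau_pow_swap (tau : tracialState M) A B n :
  tau ((1 - A * B) ^+ n) = tau ((1 - B * A) ^+ n).
Proof.
have comm1 : (1 - A * B) * A = A * (1 - B * A).
  by rewrite mulrBl mul1r mulrBr mulr1 mulrA.
have comm m : (1 - A * B) ^+ m * A = A * (1 - B * A) ^+ m.
  elim: m => [|m IH]; first by rewrite !expr0 mul1r mulr1.
  by rewrite exprSr -mulrA comm1 mulrA IH -mulrA -exprSr.
elim: n => [|n IH]; first by rewrite !expr0.
rewrite !exprSr !mulrBr !mulr1 !trB IH; congr (_ - _).
by rewrite mulrA comm -mulrA trM -mulrA.
Qed.

(** A square root [Z] of [1 - star A * A] displays the quadratic form of the powers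
    [(1 - star A * A) ^ n] as the square norms of the [Z ^ n x]. *)
Lemma sqrt_complement A : opbound 1 A ->
  exists Z : M, [/\ star Z = Z, Z * Z = 1 - star A * A & opbound 1 Z].
Proof.
move=> A1; have A1' : opbound 1 (star A) by exact: opbound_star.
have [Z [Zs Z2 _ _]] : exists Z : M, [/\ star Z = Z, Z * Z = 1 - star A * A,
    opbound 1 (1 - Z) &
    forall B, B * (star A * A) = star A * A * B -> B * Z = Z * B].
  apply: op_sqrt; first by rewrite starM starK.
  by rewrite -[1]mulr1; exact: opboundM.
exists Z; split => // x; rewrite mul1r -(@ler_pXn2r _ 2) ?nnegrE ?rnorm_ge0 //.
rewrite -rip_starM Zs Z2 vn_funB ripBl vn_fun1 rip_rnorm.
by rewrite rip_starM lerBlDr lerDl sqr_ge0.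
Qed.

(** With [W = 1 - A * star A], the powers [W ^ n] decrease strongly to the projection
    [1 - r] onto the kernel of [star A]. They have the same traces as the powers of
    [1 - star A * A], which are at least [1 - e]; normality then bounds the trace of
    [r] without any partial isometry between the ranges of [A] and [star A]. *)
Lemma range_projection_contraction (tau : tracialState M) A :
  normal_state tau -> opbound 1 A ->
  exists r : M, [/\ projection r, r * A = A,
    forall B, B * A = 0 -> B * r = 0 &
    forall e, projection e -> A * e = A -> tau r <= tau e].
Proof.
move=> tauN A1; set W : M := 1 - A * star A.
have A1' : opbound 1 (star A) by exact: opbound_star.
have [Z [Zs Z2 Z1]] := sqrt_complement A1'; rewrite starK in Z2.
have [Z' [Zs' Z2' _]] := sqrt_complement A1.
have WE n : W ^+ n = star (Z ^+ n) * Z ^+ n.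
  by rewrite star_exp // /W -Z2 -expr2 -exprM mulnC -expr2 -exprM.
have Ws n : star (W ^+ n) = W ^+ n by rewrite WE starM starK.
have Wx n x : rip ((W ^+ n) x) x = rnorm ((Z ^+ n) x) ^+ 2.
  by rewrite WE rip_starM.
have W1 n : opbound 1 (W ^+ n).
  rewrite WE star_exp //; rewrite -[1]mulr1.
  by apply: opboundM => //; exact: opboundX.
have Cb n : opbound (1 + 1) (1 - W ^+ n) by apply: opboundB => //; exact: opbound1.
have Cs n : star (1 - W ^+ n) = 1 - W ^+ n by rewrite starB star1 Ws.
have Ci n x : rip ((1 - W ^+ n) x) x <= rip ((1 - W ^+ n.+1) x) x.
  rewrite !vn_funB !ripBl lerD2l lerN2 !Wx [Z ^+ n.+1]exprS vn_funM.
  rewrite ler_pXn2r ?nnegrE ?rnorm_ge0 //.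
  by apply: le_trans (Z1 _) _; rewrite mul1r.
have [r [rs Cr _]] := monotone_limit (addr_ge0 ler01 ler01) Cs Cb Ci.
have WN : sot_cvg (fun n => W ^+ n) (1 - r).
  have := sot_add (@sot_cst _ _ M 1) (sot_opp Cr).
  by under eq_fun do rewrite opprB addrC subrK.
set N := 1 - r in WN *.
have Ns : star N = N by rewrite starB star1 rs.
have WNN : W * N = N.
  have h : sot_cvg (fun n => W * W ^+ n) (W * N).
    apply: (@sot_comp _ _ _ (fun=> W) _ W N 1) => // [_|]; last exact: sot_cst.
    by rewrite -[W]expr1.
  apply: sot_uniq h _ => x; under eq_fun do rewrite -exprS.
  by move: (WN x); rewrite -(@cvg_shiftS _ (fun n => (W ^+ n) x)).
have NN : N * N = N.
  have WnN n : W ^+ n * N = N.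
    by elim: n => [|n IH]; rewrite ?expr0 ?mul1r // exprSr -mulrA WNN.
  apply: (@sot_uniq _ _ _ (fun n => W ^+ n * N)).
    by apply: (@sot_comp _ _ _ _ (fun=> N) N N 1) => //; exact: sot_cst.
  by move=> x; under eq_fun do rewrite WnN; exact: cvg_cst.
have rE : r = 1 - N by rewrite /N opprB addrC subrK.
have AN : star A * N = 0.
  apply: starM_eq0; rewrite starM starK Ns -mulrA (mulrA A).
  have -> : A * star A * N = 0.
    have -> : A * star A = 1 - W by rewrite /W opprB addrC subrK.
    by rewrite mulrBl mul1r WNN subrr.
  by rewrite mulr0.
exists r; split.
- by split => //; rewrite rE mulrBr mulr1 mulrBl mul1r NN subrr subr0.
- rewrite rE mulrBl mul1r -[A in _ * A]starK -Ns -starM AN star0 subr0 //.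
- move=> B BA; have BW n : B * W ^+ n = B.
    elim: n => [|n IH]; first by rewrite expr0 mulr1.
    by rewrite exprS mulrA mulrBr mulr1 mulrA BA mul0r subr0.
  have [k _ Bk] := opbound_ex B.
  have BN : B * N = B.
    apply: (@sot_uniq _ _ _ (fun n => B * W ^+ n)).
      by apply: (@sot_comp _ _ _ (fun=> B) _ B N k) => //; exact: sot_cst.
    by move=> x; under eq_fun do rewrite BW; exact: cvg_cst.
  by rewrite rE mulrBr mulr1 BN subrr.
- move=> e [es ee] Ae; apply: normal_seq_le tauN Cs Ci Cr _ => n.
  rewrite trB tau_pow_swap tr1 -subr_ge0.
  set V := (1 - star A * A) ^+ n.
  have eA : star A = e * star A by rewrite -{1}Ae starM es.
  have VE : V = star (Z' ^+ n) * Z' ^+ n.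
    by rewrite star_exp // /V -Z2' -expr2 -exprM mulnC -expr2 -exprM.
  have Vs : star V = V by rewrite VE starM starK.
  have Vf : V * (1 - e) = 1 - e.
    have h : (1 - star A * A) * (1 - e) = 1 - e.
      by rewrite mulrBl mul1r -mulrA mulrBr mulr1 Ae subrr mulr0 subr0.
    rewrite /V; elim: n {V VE Vs} => [|n IH]; first by rewrite expr0 mul1r.
    by rewrite exprSr -mulrA h IH.
  have fV : (1 - e) * V = 1 - e.
    by have := congr1 star Vf; rewrite starM Vs starB star1 es.
  have Ve : V * e = V - (1 - e) by rewrite -Vf mulrBr mulr1 opprB addrC subrK.
  have eV : e * V = V - (1 - e) by rewrite -fV mulrBl mul1r opprB addrC subrK.
  have -> : tau e - (1 - tau V) = tau (star (Z' ^+ n * e) * (Z' ^+ n * e)).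
    rewrite starM es -mulrA (mulrA (star _)) -VE Ve mulrBr mulrBr mulr1 ee subrr.
    by rewrite subr0 eV !trB tr1 !opprB addrCA.
  exact: tr_starM_ge0.
Qed.

Lemma range_projection (tau : tracialState M) A : normal_state tau ->
  exists r : M, [/\ projection r, r * A = A,
    forall B, B * A = 0 -> B * r = 0 &
    forall e, projection e -> A * e = A -> tau r <= tau e].
Proof.
move=> tauN; have [k k0 Ak] := opbound_ex A.
have kn0 : (k%:C%C : R[i]) != 0 by rewrite (inj_eq (@complexI R)) gt_eqF.
have A1 : opbound 1 (k^-1%:C%C *: A).
  have -> : 1 = k^-1 * k :> R by rewrite mulVf // gt_eqF.
  by apply: opboundZ => //; rewrite invr_ge0 ltW.
have AE : A = k%:C%C *: (k^-1%:C%C *: A).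
  by rewrite scalerA -rmorphM /= divff ?gt_eqF // scale1r.
have [r [rp rA r0 rt]] := range_projection_contraction tauN A1.
exists r; split => //.
- by rewrite AE -scalerAr rA.
- by move=> B BA; apply: r0; rewrite -scalerAr BA scaler0.
- by move=> e ep Ae; apply: rt => //; rewrite -scalerAl Ae.
Qed.

End RangeProjection.

(** * Projections and their traces *)

Section Projections.
Context {R : realType} {H : hilbertType R} {M : vnAlgebra H}.
Variable tau : tracialState M.
Implicit Types (x y z : H) (A B D L Z p q r e f g : M) (k : R).

Definition tdim p : R := complex.Re (tau p).

Lemma tdimD p q : tdim (p + q) = tdim p + tdim q.
Proof. by rewrite /tdim raddfD ReD. Qed.

Lemma tdimB p q : tdim (p - q) = tdim p - tdim q.
Proof. by apply: (addIr (tdim q)); rewrite -tdimD !subrK. Qed.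

Lemma tdim0 : tdim 0 = 0.
Proof. by rewrite /tdim raddf0. Qed.

Lemma tdim1 : tdim 1 = 1.
Proof. by rewrite /tdim tr1. Qed.

Lemma tau_tdim p : projection p -> tau p = (tdim p)%:C%C.
Proof.
by move=> [ps pp]; rewrite RRe_real // ger0_real // -pp -{1}ps tr_starM_ge0.
Qed.

Lemma tdim_ge0 p : projection p -> 0 <= tdim p.
Proof.
move=> pP; rewrite -ler0c -tau_tdim //; case: pP => ps pp.
by rewrite -pp -{1}ps tr_starM_ge0.
Qed.

Lemma tdim_eq0 p : faithful_state tau -> projection p -> tdim p = 0 -> p = 0.
Proof.
move=> tauF pP p0; apply: tauF; have [ps pp] := pP.
by rewrite ps pp tau_tdim // p0.
Qed.

Lemma projection0 : projection (0 : M).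
Proof. by split; rewrite ?star0 ?mulr0. Qed.

Lemma projection1 : projection (1 : M).
Proof. by split; rewrite ?star1 ?mulr1. Qed.

Lemma proj_star p q : projection p -> projection q -> q * p = p -> p * q = p.
Proof. by move=> [ps _] [qs _] /(congr1 star); rewrite starM ps qs. Qed.

Lemma proj_orthC p q : projection p -> projection q -> q * p = 0 -> p * q = 0.
Proof. by move=> [ps _] [qs _] /(congr1 star); rewrite starM ps qs star0. Qed.

Lemma projectionD p q : projection p -> projection q -> p * q = 0 ->
  projection (p + q).
Proof.
move=> pP qP pq; have qp := proj_orthC qP pP pq.
case: pP qP => [ps pp] [qs qq]; split; first by rewrite starD ps qs.
by rewrite mulrDl !mulrDr pp qq pq qp addr0 add0r.
Qed.

Lemma projectionB p q : projection p -> projection q -> q * p = p ->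
  projection (q - p).
Proof.
move=> pP qP qp; have pq := proj_star pP qP qp.
case: pP qP => [ps pp] [qs qq]; split; first by rewrite starB ps qs.
by rewrite mulrBl !mulrBr pp qq pq qp subrr subr0.
Qed.

Lemma tdim_le p q : projection p -> projection q -> q * p = p -> tdim p <= tdim q.
Proof.
by move=> pP qP qp; rewrite -subr_ge0 -tdimB tdim_ge0 //; exact: projectionB.
Qed.

Lemma rip_proj p x : projection p -> rip (p x) x = rnorm (p x) ^+ 2.
Proof. by move=> [ps pp]; rewrite -rip_starM ps pp. Qed.

Lemma opbound_proj p : projection p -> opbound 1 p.
Proof.
move=> pP x; have := projectionB pP projection1 (mul1r p).
move=> /(rip_proj x); rewrite vn_funB ripBl vn_fun1 rip_rnorm rip_proj // => h.
rewrite mul1r -(@ler_pXn2r _ 2) ?nnegrE ?rnorm_ge0 //.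
by rewrite -subr_ge0 h sqr_ge0.
Qed.

End Projections.

Section Diffuse.
Context {R : realType} {H : hilbertType R} {M : vnAlgebra H}.
Variable tau : tracialState M.
Hypothesis tauF : faithful_state tau.
Hypothesis tauN : normal_state tau.
Hypothesis Mdiffuse : no_abelian_projection M.
Implicit Types (x y z : H) (A B D L Z p q r e f g : M) (k : R).

(** Every operator is a combination of two self-adjoint ones. *)
Lemma scalar_corner p :
  (forall A, star A = A -> exists c : R[i], p * A * p = c *: p) ->
  forall A, exists c : R[i], p * A * p = c *: p.
Proof.
move=> hsa A; have [c hc] : exists c : R[i], p * (A + star A) * p = c *: p.
  by apply: hsa; rewrite starD starK addrC.
have [d hd] : exists c : R[i], p * ('i *: (A - star A)) * p = c *: p.
  by apply: hsa; rewrite starZ starB starK conjCi scaleNr -scalerN opprB.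
exists (2^-1 * (c - 'i * d)).
have hd' : p * (A - star A) * p = (- 'i * d) *: p.
  rewrite -scalerA -hd -scalerAr -scalerAl scalerA mulNr -expr2 sqrCi opprK.
  by rewrite scale1r.
have -> : A = 2^-1 *: ((A + star A) + (A - star A)).
  rewrite addrACA subrr addr0 -[X in X + _]scale1r -[X in _ + X]scale1r -scalerDl.
  by rewrite scalerA mulVf ?pnatr_eq0 // scale1r.
by rewrite -scalerAr -scalerAl mulrDr mulrDl hc hd' -scalerDl scalerA mulNr.
Qed.

(** The corner [p M p] is not commutative, so it contains a self-adjoint operator
    that is not a multiple of [p]; subtracting its mean makes the trace 0. *)
Lemma corner_selfadj p : projection p -> p != 0 ->
  exists b : M, [/\ star b = b, b != 0, p * b = b, tau b = 0 & opbound 1 b].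
Proof.
move=> pP p0; have [ps pp] := pP.
have taup0 : tau p != 0.
  apply: contra_neq p0 => h; apply: (tdim_eq0 tauF pP).
  by rewrite /tdim h.
have [A [As An]] : exists A, star A = A /\ forall c : R[i], p * A * p <> c *: p.
  apply: contrapT => hn.
  have h A : star A = A -> exists c : R[i], p * A * p = c *: p.
    move=> As; apply: contrapT => hA; apply: hn; exists A; split => // c hc.
    by apply: hA; exists c.
  move/eqP: p0; apply; apply: Mdiffuse => // B C.
  have [c ->] := scalar_corner h B; have [d ->] := scalar_corner h C.
  by rewrite -!scalerAl -!scalerAr !scalerA mulrC.
pose l := tau (p * A * p) / tau p.
pose b := p * A * p - l *: p.
have pAps : star (p * A * p) = p * A * p by rewrite !starM As ps mulrA.
have lr : l^* = l.
  rewrite /l rmorphM /= -tr_star pAps; congr (_ * _).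
  by rewrite fmorphV /= -tr_star ps.
have bs : star b = b by rewrite starB starZ lr pAps ps.
have b0 : b != 0 by rewrite subr_eq0; apply/eqP; exact: An.
have pb : p * b = b.
  by rewrite /b mulrBr -scalerAr pp !mulrA pp.
have tb : tau b = 0 by rewrite trB trZ divfK // subrr.
have [k k0 bk] := opbound_ex b.
have kn0 : (k^-1%:C%C : R[i]) != 0.
  by rewrite (inj_eq (@complexI R)) invr_eq0 gt_eqF.
exists (k^-1%:C%C *: b); split.
- by rewrite starZ bs conj_Creal // complex_real.
- by rewrite scaler_eq0 negb_or kn0.
- by rewrite -scalerAr pb.
- by rewrite trZ tb mulr0.
- have -> : 1 = k^-1 * k :> R by rewrite mulVf // gt_eqF.
  by apply: opboundZ => //; rewrite invr_ge0 ltW.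
Qed.

(** With [b] as in [corner_selfadj] and [c = |b|], the operators [c + b] and
    [c - b] have product 0. If one of them vanished, then [c] would have trace 0,
    and [c] is a square, so [b] would vanish. Hence the range projection of
    [c + b] is neither 0 nor [p]. *)
Lemma proper_subprojection p : projection p -> p != 0 ->
  exists r : M, [/\ projection r, p * r = r, r != 0 & r != p].
Proof.
move=> pP p0; have [ps pp] := pP.
have [b [bs b0 pb tb b1]] := corner_selfadj pP p0.
have bp : b * p = b by rewrite -{1}bs -{1}ps -starM pb.
have [Z [Zs Z2 Z1]] := sqrt_complement b1; rewrite bs in Z2.
(* [Z ^ 2 = 1 - b ^ 2], so that [c ^ 2 = b ^ 2]. *)
have [c [cs c2 c1 cb]] : exists Z' : M, [/\ star Z' = Z', Z' * Z' = 1 - Z * Z,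
    opbound 1 (1 - Z') & forall B, B * (Z * Z) = Z * Z * B -> B * Z' = Z' * B].
  apply: op_sqrt; first by rewrite starM Zs.
  by rewrite -[1]mulr1; exact: opboundM.
rewrite Z2 opprB addrC subrK in c2.
have {}cb : b * c = c * b.
  by apply: cb; rewrite Z2 mulrBr mulrBl mulr1 mul1r mulrA.
(* [c] is itself a square, since [1 - c] is again a self-adjoint contraction. *)
have c_tr : tau c != 0.
  have cs' : star (1 - c) = 1 - c by rewrite starB star1 cs.
  have [z [zs z2 _ _]] := op_sqrt cs' c1.
  rewrite opprB addrC subrK in z2.
  apply/eqP => tc; have z0 : z = 0 by apply: tauF; rewrite zs z2.
  move/eqP: b0; apply; apply: starM_eq0.
  by rewrite bs -c2 -z2 z0 !mulr0.
have cp : c * p = c.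
  apply/eqP; rewrite eq_sym -subr_eq0 -[X in X - _]mulr1 -mulrBr; apply/eqP.
  apply: starM_eq0; rewrite starM cs -mulrA (mulrA c) c2 -mulrA [b * (1 - p)]mulrBr.
  by rewrite mulr1 bp subrr !mulr0.
have pc : p * c = c by rewrite -{1}cs -{1}ps -starM cp.
have [r [rP rc r0 _]] := range_projection (c + b) tauN.
exists r; split => //.
- apply/eqP; rewrite eq_sym -subr_eq0 -[X in X - _]mul1r -mulrBl; apply/eqP/r0.
  by rewrite mulrBl mul1r mulrDr pc pb subrr.
- apply: contra_neq c_tr => r_0.
  have /eqP : c + b = 0 by rewrite -rc r_0 mul0r.
  by rewrite addr_eq0 => /eqP ->; rewrite -scaleN1r trZ tb mulr0.
- apply: contra_neq c_tr => r_p.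
  have : (c - b) * r = 0.
    by apply: r0; rewrite mulrBl !mulrDr c2 cb [_ + b * b]addrC subrr.
  rewrite r_p mulrBl cp bp => /eqP; rewrite subr_eq0 => /eqP ->.
  by rewrite tb.
Qed.

(** One of a proper subprojection and its complement has at most half the trace. *)
Lemma half_subprojection p : projection p -> p != 0 ->
  exists r : M, [/\ projection r, p * r = r, r != 0 & tdim tau r <= tdim tau p / 2].
Proof.
move=> pP p0; have [r [rP pr r0 rp]] := proper_subprojection pP p0.
have [h|h] := leP (tdim tau r) (tdim tau p / 2); first by exists r.
exists (p - r); split.
- exact: projectionB.
- by rewrite mulrBr pr; case: pP => _ ->.
- by rewrite subr_eq0 eq_sym.
- by rewrite tdimB; lra.
Qed.

Lemma small_subprojection p (s : R) : projection p -> p != 0 -> 0 < s ->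
  exists r : M, [/\ projection r, p * r = r, r != 0 & tdim tau r <= s].
Proof.
move=> pP p0 s0.
have h n : exists r : M,
    [/\ projection r, p * r = r, r != 0 & tdim tau r <= tdim tau p / n.+1%:R].
  elim: n => [|n [r [rP pr r0 rn]]].
    by exists p; split => //; [case: pP|rewrite divr1].
  have [q [qP rq q0 qr]] := half_subprojection rP r0.
  exists q; split => //; first by rewrite -rq mulrA pr.
  apply: le_trans qr _; rewrite ler_pdivrMr //.
  apply: le_trans rn _; rewrite -mulrA ler_wpM2l ?tdim_ge0 //.
  rewrite mulrC ler_pdivlMr ?ltr0n // ler_pdivrMl ?ltr0n //.
  by rewrite -natrM ler_nat muln2 doubleS !ltnS -addnn leq_addr.
have [r [rP pr r0 rn]] := h (Num.bound (tdim tau p / s)).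
exists r; split => //; apply: le_trans rn _.
rewrite ler_pdivrMr ?ltr0n // mulrC -ler_pdivrMr //.
apply/ltW/(lt_le_trans (archi_boundP _)); last by rewrite ler_nat.
by rewrite divr_ge0 ?tdim_ge0 // ltW.
Qed.

End Diffuse.

(** * Subprojections of prescribed trace *)

Section IntermediateTrace.
Context {R : realType} {H : hilbertType R} {M : vnAlgebra H}.
Variable tau : tracialState M.
Hypothesis tauF : faithful_state tau.
Hypothesis tauN : normal_state tau.
Hypothesis Mdiffuse : no_abelian_projection M.
Implicit Types (x y z : H) (A B D L Z p q r e f g : M) (k : R).

(** The steps that a subprojection [p] of [f] can take without exceeding the
    trace [s]. *)
Definition admissible f (s : R) p e :=
  [/\ projection e, (f - p) * e = e & tdim tau e <= s - tdim tau p].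

Lemma greedy_choice f s p : projection f -> projection p -> f * p = p ->
  tdim tau p <= s ->
  exists e, admissible f s p e /\
    forall e', admissible f s p e' -> tdim tau e' <= 2 * tdim tau e.
Proof.
move=> fP pP fp ps; pose S : set R := [set tdim tau e | e in admissible f s p].
have S0 : S 0.
  exists 0; last exact: tdim0.
  by split; rewrite ?mulr0 ?tdim0 ?subr_ge0 //; exact: projection0.
have Ssup : has_sup S.
  split; first by exists 0.
  by exists (s - tdim tau p) => _ [e [_ _ es] <-].
have [sup0|supp] := leP (sup S) 0.
  exists 0; split.
    by split; rewrite ?mulr0 ?tdim0 ?subr_ge0 //; exact: projection0.
  move=> e' e'S; rewrite tdim0 mulr0; apply: le_trans sup0.
  by apply: sup_upper_bound => //; exists e'.
have [_ [e eS <-] he] := sup_adherent (divr_gt0 supp (ltr0Sn _ 1)) Ssup.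
exists e; split => // e' e'S.
have : tdim tau e' <= sup S by apply: sup_upper_bound => //; exists e'.
lra.
Qed.

(** Grow [g] greedily, each step taking at least half of what is still possible.
    The traces added tend to 0, so if the supremum had trace less than [s], a
    small subprojection of its complement in [f] would have been a better choice
    at some step. *)
Lemma intermediate_subprojection f s : projection f -> 0 <= s -> s <= tdim tau f ->
  exists g : M, [/\ projection g, f * g = g & tdim tau g = s].
Proof.
move=> fP s0 sf; have [fs ff] := fP.
have /choice [step stepP] : forall p, exists e,
    projection p /\ f * p = p /\ tdim tau p <= s -> admissible f s p e /\
    forall e', admissible f s p e' -> tdim tau e' <= 2 * tdim tau e.
  move=> p.
  have [[pP [fp ps]]|hn] := pselect (projection p /\ f * p = p /\ tdim tau p <= s).
    by have [e he] := greedy_choice fP pP fp ps; exists e.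
  by exists 0.
pose P := fix P n : M := if n is n'.+1 then P n' + step (P n') else 0.
have PS n : P n.+1 = P n + step (P n) by [].
have Pinv n : projection (P n) /\ f * P n = P n /\ tdim tau (P n) <= s.
  elim: n => [|n [pP [fp ps]]].
    by split; [exact: projection0|rewrite mulr0 tdim0].
  have [[eP fe es] _] := stepP _ (conj pP (conj fp ps)).
  have pe : P n * step (P n) = 0.
    have pf := proj_star pP fP fp.
    by rewrite -fe mulrA mulrBr pf; case: pP => _ ->; rewrite subrr mul0r.
  rewrite PS; split; first exact: projectionD.
  split; last by rewrite tdimD addrC -lerBrDr.
  rewrite mulrDr fp; congr (_ + _).
  by rewrite -[LHS]addr0 -[0 in LHS]oppr0 -pe -mulrBl.
have eP n : projection (step (P n)) by have [[]] := stepP _ (Pinv n).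
have Pi n x : rip (P n x) x <= rip (P n.+1 x) x.
  by rewrite PS vn_funD ripDl lerDl rip_proj // sqr_ge0.
have Ps n : star (P n) = P n by have [[]] := Pinv n.
have Pb n : opbound 1 (P n) by have [pP _] := Pinv n; exact: opbound_proj.
have [g [gs Pg _]] := monotone_limit ler01 Ps Pb Pi.
have gg : g * g = g.
  apply: sot_uniq (sot_comp Pb Pg Pg) _ => x.
  under eq_fun => n do (have [[_ ->] _] := Pinv n).
  exact: Pg.
have gP : projection g by [].
have fg : f * g = g.
  have [k _ fk] := opbound_ex f.
  apply: (@sot_uniq _ _ _ (fun n => f * P n)).
    by apply: (@sot_comp _ _ _ (fun=> f) _ f g k) => //; exact: sot_cst.
  move=> x; under eq_fun => n do (have [_ [-> _]] := Pinv n).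
  exact: Pg.
have gle : tdim tau g <= s.
  rewrite -lecR -tau_tdim //; apply: (normal_seq_le tauN Ps Pi Pg) => n.
  by have [pP [_ ps]] := Pinv n; rewrite tau_tdim // lecR.
(* [g] dominates [P n] as a quadratic form, so [P n] vanishes where [g] does. *)
have Pg_abs n : P n * g = P n.
  apply/eqP; rewrite eq_sym -subr_eq0 -[X in X - _]mulr1 -mulrBr; apply/eqP.
  apply: rnorm0_eq0 => x; rewrite vn_funM; set y := (1 - g) x.
  have gy : g y = 0.
    by rewrite /y -vn_funM mulrBr mulr1 gg subrr vn_0fun.
  have := sot_rip_incr y Pi Pg n; rewrite (rip_proj _ gP) gy rnorm0 expr0n /=.
  rewrite rip_proj; last by have [] := Pinv n.
  move=> h.
  by apply/eqP; rewrite -sqrf_eq0 eq_le h sqr_ge0.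
exists g; split => //; apply/eqP; rewrite eq_le gle /= leNgt; apply/negP => gs'.
have fgP := projectionB gP fP fg.
have fg0 : f - g != 0.
  apply/eqP => h; have : tdim tau (f - g) = 0 by rewrite h tdim0.
  rewrite tdimB => /eqP; rewrite subr_eq0 => /eqP h'.
  by move: gs'; rewrite -h' ltNge sf.
have sg0 : 0 < s - tdim tau g by rewrite subr_gt0.
have [e [eP' fge e0 es]] := small_subprojection tauF tauN Mdiffuse fgP fg0 sg0.
have ge : g * e = 0.
  have gf := proj_star gP fP fg.
  by rewrite -fge mulrA mulrBr gf gg subrr mul0r.
have fe : f * e = e by rewrite -{2}fge mulrBl ge subr0.
(* Being orthogonal to [g], the projection [e] is admissible at every step. *)
have e_adm n : tdim tau e <= 2 * tdim tau (step (P n)).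
  have [pP [fp ps]] := Pinv n; have [_] := stepP _ (Pinv n); apply; split => //.
    by rewrite mulrBl fe -Pg_abs -mulrA ge mulr0 subr0.
  apply: le_trans es _; rewrite lerD2l lerN2.
  apply: tdim_le => //.
  by have := congr1 star (Pg_abs n); rewrite starM gs Ps.
have Pn n : n%:R * (tdim tau e / 2) <= tdim tau (P n).
  elim: n => [|n IH]; first by rewrite mul0r tdim0.
  rewrite PS tdimD -natr1 mulrDl mul1r lerD // ler_pdivrMr // mulrC.
  exact: e_adm.
have e_pos : 0 < tdim tau e.
  rewrite lt_def tdim_ge0 // andbT; apply: contra_neq e0; exact: tdim_eq0.
have [n hn] : exists n : nat, s < n%:R * (tdim tau e / 2).
  exists (Num.bound (s / (tdim tau e / 2))).
  rewrite -ltr_pdivrMr ?divr_gt0 //; apply: archi_boundP.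
  by rewrite !divr_ge0 // ltW.
have [_ [_ ps]] := Pinv n.
by have := le_trans (Pn n) ps; rewrite leNgt hn.
Qed.

End IntermediateTrace.

(** * Approximately invariant flags *)

Section KrylovFlag.
Context {R : realType} {H : hilbertType R} {M : vnAlgebra H}.
Variable tau : tracialState M.
Hypothesis tauF : faithful_state tau.
Hypothesis tauN : normal_state tau.
Hypothesis Mdiffuse : no_abelian_projection M.
Implicit Types (A B T V p q r e f g : M) (k s : R).

(** What is known about the sum [V] of the pieces of an unfinished flag and its
    last piece [g], as a pair [(V, g)]. *)
Definition flag_state T s (Vg : M * M) :=
  [/\ projection Vg.1, projection Vg.2, tdim tau Vg.2 <= s &
      (1 - Vg.1) * T * Vg.1 = (1 - Vg.1) * T * Vg.2].

(** [T] maps the range of [V] into the sum of the ranges of [V] and of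
    [r = range ((1 - V) T g)], and [r] is no larger than [g]. So a projection
    [g'] of trace [s] above [r] absorbs all that leaks out of [V]; what leaks out
    of [V + g'] can only come from [g']. *)
Lemma flag_step T s V g : flag_state T s (V, g) -> tdim tau V + s <= 1 ->
  exists g', [/\ V * g' = 0, tdim tau g' = s & flag_state T s (V + g', g')].
Proof.
move=> [/= VP gP gs Tg] Vs; have [_ VV] := VP.
have fP := projectionB VP (projection1 (M := M)) (mul1r V).
have [r [rP rA r0 rt]] := range_projection ((1 - V) * T * g) tauN.
have rs : tdim tau r <= s.
  apply: le_trans gs; rewrite -lecR -!tau_tdim //; apply: rt => //.
  by rewrite -(mulrA _ g g); case: gP => _ ->.
have Vr : V * r = 0.
  by apply: r0; rewrite !mulrA mulrBr mulr1 VV subrr !mul0r.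
have fr : (1 - V) * r = r by rewrite mulrBl mul1r Vr subr0.
have rf : r * (1 - V) = r by exact: proj_star.
have frP := projectionB rP fP fr.
have [h [hP frh hs]] : exists h, [/\ projection h, (1 - V - r) * h = h &
    tdim tau h = s - tdim tau r].
  apply: intermediate_subprojection => //; first by rewrite subr_ge0.
  by rewrite !tdimB tdim1 lerD2r lerBrDl.
have rh : r * h = 0.
  by rewrite -frh mulrA mulrBr rf; case: rP => _ ->; rewrite subrr mul0r.
have Vh : V * h = 0.
  by rewrite -frh mulrA !mulrBr mulr1 VV Vr subrr subr0 mul0r.
have g'P : projection (r + h) by exact: projectionD.
have Vg' : V * (r + h) = 0 by rewrite mulrDr Vr Vh addr0.
have g's : tdim tau (r + h) = s by rewrite tdimD hs addrC subrK.
exists (r + h); split => //; split => /=.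
- exact: projectionD.
- by [].
- by rewrite g's.
have leak : (1 - (V + (r + h))) * ((1 - V) * T * g) = 0.
  rewrite -rA mulrA; have -> : (1 - (V + (r + h))) * r = 0; last by rewrite mul0r.
  rewrite mulrBl mul1r !mulrDl Vr add0r; case: (rP) => _ ->.
  by rewrite (proj_orthC hP rP rh) addr0 subrr.
have ff : (1 - (V + (r + h))) * (1 - V) = 1 - (V + (r + h)).
  rewrite mulrBr mulr1 mulrBl mul1r mulrDl VV.
  by rewrite (proj_orthC g'P VP Vg') addr0 subrr subr0.
rewrite mulrDr -[X in X + _]mulrA -{1}ff -mulrA [X in _ * X]mulrA Tg leak.
by rewrite add0r.
Qed.

(** The analogue of the Krylov flag of a matrix, with pieces of trace [1 / N] in
    the role of the basis vectors. *)
Lemma approximate_flag T k N : (0 < N)%N -> 0 < k -> opbound k T ->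
  exists V : nat -> M,
    [/\ forall i, (i <= N)%N -> projection (V i),
        forall i, (i <= N)%N -> tdim tau (V i) = i%:R / N%:R,
        forall i j, (i <= j <= N)%N -> V j * V i = V i &
        forall i, (i <= N)%N ->
          sqnorm2 tau ((1 - V i) * T * V i) <= k ^+ 2 / N%:R].
Proof.
move=> N0 k0 Tk; set s : R := N%:R^-1.
have N0' : 0 < N%:R :> R by rewrite ltr0n.
have s0 : 0 <= s by rewrite invr_ge0 ltW.
have /choice [next nextP] : forall Vg : M * M, exists g',
    flag_state T s Vg -> tdim tau Vg.1 + s <= 1 ->
    [/\ Vg.1 * g' = 0, tdim tau g' = s & flag_state T s (Vg.1 + g', g')].
  move=> [V g]; have [VgS|] := pselect (flag_state T s (V, g)); last by exists 0.
  have [Vs|] := pselect (tdim tau V + s <= 1); last by exists 0.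
  by have [g' hg'] := flag_step VgS Vs; exists g'.
pose st := fix st n : M * M :=
  if n is n'.+1 then ((st n').1 + next (st n'), next (st n')) else (0, 0).
have stP n : (n <= N)%N -> flag_state T s (st n) /\ tdim tau (st n).1 = n%:R / N%:R.
  elim: n => [|n IH] nN.
    split; last by rewrite tdim0 mul0r.
    by split; rewrite /= ?mulr0 ?tdim0 //; exact: projection0.
  have [stS stn] := IH (ltnW nN).
  have [] := nextP _ stS.
    by rewrite stn /s -[X in _ + X]mul1r -mulrDl natr1 ler_pdivrMr // mul1r ler_nat.
  move=> _ ns nS; split; first exact: nS.
  by rewrite /= tdimD ns stn /s -[X in _ + X]mul1r -mulrDl natr1.
have st_incr n : (n < N)%N -> (st n).1 * next (st n) = 0.
  move=> nN; have [stS stn] := stP n (ltnW nN).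
  have [] := nextP _ stS => //.
  by rewrite stn /s -[X in _ + X]mul1r -mulrDl natr1 ler_pdivrMr // mul1r ler_nat.
exists (fun n => (st n).1); split.
- by move=> i /stP[[]].
- by move=> i /stP[].
- move=> i j /andP[ij jN]; elim: j ij jN => [|j IH].
    by rewrite leqn0 => /eqP -> _; rewrite mulr0.
  rewrite leq_eqVlt => /orP[/eqP -> /stP[[[_ ->]]]//|].
  rewrite ltnS => ij jN; have h := IH ij (ltnW jN).
  have [[jP _ _ _] _] := stP j (ltnW jN); have [[_ nP _ _] _] := stP j.+1 jN.
  rewrite /= mulrDl h -[(st i).1 in X in _ + X]h mulrA.
  by rewrite (proj_orthC nP jP (st_incr j jN)) mul0r addr0.
- move=> i /stP[[VP gP gs Tg] _]; rewrite Tg.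
  have B : opbound k ((1 - (st i).1) * T).
    rewrite -[k]mul1r; apply: opboundM => //; apply: opbound_proj.
    exact: projectionB VP projection1 (mul1r _).
  apply: le_trans (sqnorm2_mull _ _ ((opboundE _ _).1 B)) _.
  rewrite ler_wpM2l ?exprn_ge0 ?(ltW k0) //.
  by rewrite /sqnorm2; case: gP => -> ->.
Qed.

End KrylovFlag.

(** * Passing to the ultrapower *)

Section Ultralimits.
Context {R : realType} {H : hilbertType R} {M : vnAlgebra H}.
Variables (tau : tracialState M) (omega : freeUltrafilter nat).

(** Freeness gives, for each [n], a member of the filter that avoids [n]. *)
Lemma fu_cofinite : \oo `<=` fu_filter omega.
Proof.
move=> A [N _ NA]; apply: filterS NA _.
elim: N => [|N IH]; first by apply: filterS (filterT) => n _.
have [B oB nB] : exists2 B, fu_filter omega B & ~ B N.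
  apply: contrapT => h.
  suff : (\bigcap_(A in fu_filter omega) A) N by rewrite (fu_free omega).
  by move=> B oB; apply: contrapT => nB; apply: h; exists B.
apply: filterS (filterI IH oB) => n [/= Nn Bn].
by rewrite /= ltn_neqAle Nn andbT; apply: contra_notN nB => /eqP ->.
Qed.

Lemma fu_cvg (T : topologicalType) (u : nat -> T) (l : T) :
  u n @[n --> \oo] --> l -> u n @[n --> fu_filter omega] --> l.
Proof. by move=> ul A /ul; exact: fu_cofinite. Qed.

Lemma cvg_real_complex (u : nat -> R) (l : R) :
  u n @[n --> \oo] --> l ->
  ((u n)%:C%C : R[i]^o) @[n --> \oo] --> (l%:C%C : R[i]^o).
Proof.
move=> /cvgrPdist_lt ul; apply/cvgrPdist_lt => e e0.
have er : (complex.Re e)%:C%C = e by rewrite RRe_real // gtr0_real.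
have e0' : 0 < complex.Re e by rewrite -ltcR er.
have := ul _ e0'; apply: filterS => n h.
rewrite -rmorphB -er /= normc_def /= expr0n addr0 sqrtr_sqr.
by rewrite ltcR.
Qed.

Lemma floor_div_cvg (t : R) : 0 <= t ->
  ((Num.truncn (t * n.+1%:R))%:R / n.+1%:R : R) @[n --> \oo] --> t.
Proof.
move=> t0; apply: (@squeeze_cvgr _ _ _ _ (fun n => t - harmonic n) (fun=> t)).
- near=> n; have tn0 : 0 <= t * n.+1%:R by rewrite mulr_ge0.
  have /andP[h1 h2] := truncn_itv tn0.
  rewrite ler_pdivrMr ?ltr0n // h1 andbT /harmonic /=.
  rewrite ler_pdivlMr ?ltr0n // mulrBl mulVf ?pnatr_eq0 //.
  by rewrite lerBlDr natr1 ltW.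
- by rewrite -[X in _ --> X]subr0; apply: cvgB;
    [exact: cvg_cst|exact: cvg_harmonic].
- exact: cvg_cst.
Unshelve. all: by end_near. Qed.

Lemma null_seq_harmonic (Y : bseq M) (c : R) :
  (forall n, sqnorm2 tau (Y n) <= c / n.+1%:R) -> null_seq tau omega Y.
Proof.
move=> Yc; apply/null_seqP/fu_cvg.
apply: (@squeeze_cvgr _ _ _ _ (fun=> 0) (fun n => c * harmonic n)).
- by near=> n; rewrite sqnorm2_ge0 Yc.
- exact: cvg_cst.
- by rewrite -[0 in X in _ --> X](mulr0 c); apply: cvgMr; exact: cvg_harmonic.
Unshelve. all: by end_near. Qed.

Lemma bseq_projection (X : nat -> M) : (forall n, projection (X n)) -> bseq_pred X.
Proof.
move=> XP; apply/asboolP; exists 1%:C%C => n x.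
by apply: (opboundE 1 (X n)).1; exact: opbound_proj.
Qed.

End Ultralimits.

Local Open Scope quotient_scope.

Theorem theorem2p1 (R : realType) (H : hilbertType R) (M : vnAlgebra H)
    (tau : tracialState M) (omega : freeUltrafilter nat)
    (M_II1 : type_II1_factor M)
    (tau_faithful : faithful_state tau) (tau_normal : normal_state tau)
    (T : ultrapower tau omega) :
  exists P : R -> ultrapower tau omega,
    [/\ forall t : R, 0 <= t <= 1 -> projection (P t),
        forall t : R, 0 <= t <= 1 -> T * P t = P t * T * P t,
        forall s t : R, 0 <= s -> s <= t -> t <= 1 -> star_le (P s) (P t) &
        forall t : R, 0 <= t <= 1 -> up_trace (P t) = t%:C%C].
Proof.
have [_ Mdiffuse _] := M_II1.
have [k k0 Tk] := (bseqP _).1 (bseq_funP (repr T)).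
have /choice [V VP] := fun n => approximate_flag tau_faithful tau_normal Mdiffuse
  (ltn0Sn n) k0 ((opboundE _ _).2 (Tk n)).
(* The cap [n.+1] makes every entry a projection, also for [t] outside [0, 1]. *)
pose idx (t : R) n := minn (Num.truncn (t * n.+1%:R)) n.+1.
have idxN t n : (idx t n <= n.+1)%N by exact: geq_minr.
have XP t : forall n, projection (V n (idx t n)).
  by move=> n; have [h _ _ _] := VP n; exact: h.
pose X t : bseq M := BSeq (bseq_projection (XP t)).
pose pi := (\pi_(ultrapower tau omega) : bseq M -> ultrapower tau omega).
have piM Y Z : pi Y * pi Z = pi (Y * Z) by exact: up_mulE.
have piS Y : star (pi Y) = pi (bstar Y) by exact: up_starE.
have piB Y Z : pi Y - pi Z = pi (Y - Z) by rewrite /pi up_addE up_oppE.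
have bstarX t : bstar (X t) = X t.
  by apply/val_inj/funext => n; have [] := XP t n.
have XX t : X t * X t = X t.
  by apply/val_inj/funext => n; have [] := XP t n.
exists (fun t => pi (X t)); split.
- by move=> t _; split; rewrite ?piS ?bstarX // piM XX.
- move=> t _; have -> : T = pi (repr T) by rewrite /pi reprK.
  rewrite !piM; apply/ultrapower_piP.
  apply: (@null_seq_harmonic _ _ _ _ _ _ (k ^+ 2)) => n.
  have [_ _ _ h] := VP n; apply: le_trans (h _ (idxN t n)).
  by rewrite mulrBl mul1r mulrBl.
- move=> s t s0 st t1.
  have Vst n : V n (idx t n) * V n (idx s n) = V n (idx s n).
    have [_ _ h _] := VP n; apply: h.
    rewrite idxN andbT /idx leq_min geq_minr andbT.
    apply: leq_trans (geq_minl _ _) _; apply: le_truncn.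
    by rewrite ler_wpM2r.
  have XsXt : X t * X s = X s by apply/val_inj/funext => n; exact: Vst.
  have XtXs : X s * X t = X s.
    apply/val_inj/funext => n.
    exact: (proj_star (XP s n) (XP t n) (Vst n)).
  exists (pi (X t) - pi (X s)).
  rewrite starB !piS !bstarX mulrBl !mulrBr !piM !XX XsXt XtXs.
  by rewrite subrr subr0.
- move=> t /andP[t0 t1]; rewrite /pi up_traceE.
  apply: (@norm_cvg_lim _ (R[i]^o)); apply: fu_cvg.
  have -> : (fun n => tau (X t n) : R[i]^o) = (fun n =>
      (((Num.truncn (t * n.+1%:R))%:R / n.+1%:R : R)%:C%C : R[i]^o)).
    apply/funext => n; have [_ h _ _] := VP n.
    rewrite -[X t n]/(V n (idx t n)) (tau_tdim _ (XP t n)).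
    rewrite h // /idx (minn_idPl _) //.
    rewrite -(ler_nat R); apply: (@le_trans _ _ (t * n.+1%:R)).
      by rewrite truncn_le mulr_ge0.
    by rewrite ler_piMl.
  exact/cvg_real_complex/floor_div_cvg.
Qed.
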